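(* Let $(G,\{A_v,\mathcal{L}_v,L_v,\rho_v\}_{v\in V},\{\phi_e\}_{e\in E})$ be a noncommutative Mauldin-Williams graph. Suppose that the graph $G$ has no sinks, and that for every $v\in V$ the state space $\mathcal{S}_v$ of $A_v$ equals the closed convex hull of $K_v$, where $(K_v)_{v\in V}$ is the unique invariant family of nonempty compact sets for the dual maps $\phi_e^*$. Then $A=\bigoplus_{v\in V}A_v$ is a commutative $C^*$-algebra.
   Context: Graphs. A graph $G=(V,E,r,s)$ consists of finite sets $V$ and $E$ and maps $r,s:E\to V$ (range and source). No sinks means $s$ is surjective. Rieffel metric. Let $A$ be a unital $C^*$-algebra, $\mathcal{L}(A)\subset A$ a dense subspace (Lipschitz elements) and $L$ a seminorm on $\mathcal{L}(A)$ (Lipschitz seminorm) such that $\{a\in\mathcal{L}(A):L(a)=0\}$ is exactly the set of scalar multiples of the identity. The Rieffel metric on the state space $\mathcal{S}$ of $A$ is $\rho(\mu,\nu)=\sup\{|\mu(a)-\nu(a)|:a\in\mathcal{L}(A),\ L(a)\le1\}$. It is always assumed that $\rho$ is bounded on $\mathcal{S}$ and that its topology is the weak-$*$ topology on $\mathcal{S}$. Noncommutative Mauldin-Williams graph. A system $(G,\{A_v,\mathcal{L}_v,L_v,\rho_v\}_{v\in V},\{\phi_e\}_{e\in E})$ where $G=(V,E,r,s)$ is a graph; each $A_v$ is a (nonzero) unital $C^*$-algebra with a Lipschitz seminorm $L_v$ on a subspace $\mathcal{L}_v\subset A_v$ of Lipschitz elements, and $\rho_v$ is the corresponding Rieffel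 metric on the state space $\mathcal{S}_v$ of $A_v$; and for each $e\in E$, $\phi_e:A_{s(e)}\to A_{r(e)}$ is a unital $*$-homomorphism with $\rho_{s(e)}(\phi_e^*(\mu),\phi_e^*(\nu))\le c\,\rho_{r(e)}(\mu,\nu)$ for all $\mu,\nu\in\mathcal{S}_{r(e)}$, for some constant $0<c<1$ (independent of $e$). Here $\phi_e^*(\mu)=\mu\circ\phi_e$. Invariant family. When $G$ has no sinks there is a unique family $(K_v)_{v\in V}$ of nonempty (weak-$*$) compact sets $K_v\subset\mathcal{S}_v$ with $K_v=\bigcup_{e\in E,\,s(e)=v}\phi_e^*(K_{r(e)})$ for all $v\in V$. *)

(* Defs.v *)
From HB Require Import structures.
From mathcomp Require Import all_boot all_order all_algebra.
From mathcomp Require Import complex.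
From mathcomp Require Import all_classical all_reals all_analysis.

Set Implicit Arguments.
Unset Strict Implicit.
Unset Printing Implicit Defensive.

Import Order.TTheory GRing.Theory Num.Theory.
Import numFieldNormedType.Exports.

Local Open Scope classical_set_scope.
Local Open Scope ring_scope.
Local Open Scope complex_scope.

(** * Unital C*-algebras *)

(* A plain record on top of [completeNormedModType]: a Hierarchy-Builder
   structure joining rings and normed modules is ruled out by the declaration
   order of the library's number structures.  The ring structure is recovered as
   a canonical instance on the carrier.  The zero algebra is allowed, so that an
   empty direct sum is a C*-algebra. *)
Record cstarAlgType (R : realType) := CStarAlg {
  cstar_banach : completeNormedModType R[i] ;
  cstar_one : cstar_banach ;
  cstar_mul : cstar_banach -> cstar_banach -> cstar_banach ;
  cstar_star : cstar_banach -> cstar_banach ;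
  cstar_mulA : associative cstar_mul ;
  cstar_mul1x : left_id cstar_one cstar_mul ;
  cstar_mulx1 : right_id cstar_one cstar_mul ;
  cstar_mulDl : left_distributive cstar_mul +%R ;
  cstar_mulDr : right_distributive cstar_mul +%R ;
  cstar_scaleAl : forall (k : R[i]) a b,
    k *: cstar_mul a b = cstar_mul (k *: a) b ;
  cstar_scaleAr : forall (k : R[i]) a b,
    k *: cstar_mul a b = cstar_mul a (k *: b) ;
  cstar_starD : {morph cstar_star : a b / a + b} ;
  cstar_starZ : forall (k : R[i]) a, cstar_star (k *: a) = k^* *: cstar_star a ;
  cstar_starM : forall a b,
    cstar_star (cstar_mul a b) = cstar_mul (cstar_star b) (cstar_star a) ;
  cstar_starK : involutive cstar_star ;
  cstar_normM_le : forall a b, `|cstar_mul a b| <= `|a| * `|b| ;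
  cstar_norm : forall a, `|cstar_mul (cstar_star a) a| = `|a| ^+ 2
}.

Definition cstar_sort (R : realType) (A : cstarAlgType R) : Type :=
  cstar_banach A.
Coercion cstar_sort : cstarAlgType >-> Sortclass.

HB.instance Definition _ (R : realType) (A : cstarAlgType R) :=
  CompleteNormedModule.copy (cstar_sort A) (cstar_banach A).
HB.instance Definition _ (R : realType) (A : cstarAlgType R) :=
  GRing.Zmodule_isPzRing.Build (cstar_sort A) (@cstar_mulA R A)
    (@cstar_mul1x R A) (@cstar_mulx1 R A) (@cstar_mulDl R A) (@cstar_mulDr R A).

Definition star (R : realType) (A : cstarAlgType R) : A -> A := @cstar_star R A.

(** * Finite direct sums *)

Section DirectSum.
Variables (R : realType) (I : finType) (A : I -> cstarAlgType R).

Definition ds_sort : Type := forall i, A i.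

Implicit Types x y z : ds_sort.

HB.instance Definition _ := Choice.copy ds_sort (forall i, A i).

Definition ds_zero : ds_sort := fun i => 0.
Definition ds_one : ds_sort := fun i => 1.
Definition ds_opp x : ds_sort := fun i => - x i.
Definition ds_add x y : ds_sort := fun i => x i + y i.
Definition ds_mul x y : ds_sort := fun i => x i * y i.
Definition ds_scale (k : R[i]) x : ds_sort := fun i => k *: x i.
Definition ds_star x : ds_sort := fun i => star (x i).

Fact ds_addA : associative ds_add.
Proof. by move=> x y z; apply/functional_extensionality_dep => i; exact: addrA. Qed.
Fact ds_addC : commutative ds_add.
Proof. by move=> x y; apply/functional_extensionality_dep => i; exact: addrC. Qed.
Fact ds_add0 : left_id ds_zero ds_add.
Proof. by move=> x; apply/functional_extensionality_dep => i; exact: add0r. Qed.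
Fact ds_addN : left_inverse ds_zero ds_opp ds_add.
Proof. by move=> x; apply/functional_extensionality_dep => i; exact: addNr. Qed.

HB.instance Definition _ :=
  GRing.isZmodule.Build ds_sort ds_addA ds_addC ds_add0 ds_addN.

Fact ds_mulA : associative ds_mul.
Proof. by move=> x y z; apply/functional_extensionality_dep => i; exact: mulrA. Qed.
Fact ds_mul1x : left_id ds_one ds_mul.
Proof. by move=> x; apply/functional_extensionality_dep => i; exact: mul1r. Qed.
Fact ds_mulx1 : right_id ds_one ds_mul.
Proof. by move=> x; apply/functional_extensionality_dep => i; exact: mulr1. Qed.
Fact ds_mulDl : left_distributive ds_mul ds_add.
Proof. by move=> x y z; apply/functional_extensionality_dep => i; exact: mulrDl. Qed.
Fact ds_mulDr : right_distributive ds_mul ds_add.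
Proof. by move=> x y z; apply/functional_extensionality_dep => i; exact: mulrDr. Qed.

Fact ds_scaleA k l x : ds_scale k (ds_scale l x) = ds_scale (k * l) x.
Proof. by apply/functional_extensionality_dep => i; exact: scalerA. Qed.
Fact ds_scale1 : left_id 1 ds_scale.
Proof. by move=> x; apply/functional_extensionality_dep => i; exact: scale1r. Qed.
Fact ds_scaleDr : right_distributive ds_scale +%R.
Proof. by move=> k x y; apply/functional_extensionality_dep => i; exact: scalerDr. Qed.
Fact ds_scaleDl x : {morph ds_scale^~ x : k l / k + l}.
Proof. by move=> k l; apply/functional_extensionality_dep => i; exact: scalerDl. Qed.

HB.instance Definition _ := GRing.Zmodule_isLmodule.Build R[i] ds_sort
  ds_scaleA ds_scale1 ds_scaleDr ds_scaleDl.

(* The maximum is taken in [R] because the order of [R[i]] is partial. *)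
Definition ds_normR x : R := \big[Num.max/0]_(i : I) complex.Re `|x i|.
Definition ds_norm x : R[i] := (ds_normR x)%:C.

Lemma norm_ReE i (a : A i) : `|a| = (complex.Re `|a|)%:C.
Proof. by rewrite RRe_real// normr_real. Qed.

Lemma ds_norm_ge0 x : 0 <= ds_norm x.
Proof. by rewrite lecR; exact: bigmax_ge_id. Qed.

Lemma ds_norm_ge x i : `|x i| <= ds_norm x.
Proof. by rewrite norm_ReE lecR; apply: le_bigmax. Qed.

Lemma ds_norm_le x (r : R[i]) :
  0 <= r -> (forall i, `|x i| <= r) -> ds_norm x <= r.
Proof.
move=> r0 xr; have rE : r = (complex.Re r)%:C by rewrite RRe_real// ger0_real.
rewrite /ds_norm rE lecR; apply: bigmax_le => [|i _].
  by rewrite -lecR -rE.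
by rewrite -lecR -rE -norm_ReE.
Qed.

Fact ds_norm_triangle x y : ds_norm (x + y) <= ds_norm x + ds_norm y.
Proof.
apply: ds_norm_le => [|i]; first by rewrite addr_ge0// ds_norm_ge0.
by rewrite (le_trans (ler_normD _ _))// lerD// ds_norm_ge.
Qed.

Fact ds_normZ (k : R[i]) x : ds_norm (k *: x) = `|k| * ds_norm x.
Proof.
apply/eqP; rewrite eq_le; apply/andP; split.
  apply: ds_norm_le => [|i]; first by rewrite mulr_ge0// ds_norm_ge0.
  by rewrite normrZ ler_wpM2l// ds_norm_ge.
have [->|k0] := eqVneq k 0; first by rewrite normr0 mul0r ds_norm_ge0.
rewrite -ler_pdivlMl ?normr_gt0//; apply: ds_norm_le => [|i].
  by rewrite mulr_ge0 ?invr_ge0 ?ds_norm_ge0.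
by rewrite ler_pdivlMl ?normr_gt0// -normrZ (ds_norm_ge (k *: x)).
Qed.

Fact ds_norm0_eq0 x : ds_norm x = 0 -> x = 0.
Proof.
move=> x0; apply/functional_extensionality_dep => i.
by apply/eqP; rewrite -normr_le0 -x0 ds_norm_ge.
Qed.

HB.instance Definition _ := Lmodule_isNormed.Build R[i] ds_sort
  ds_norm_triangle ds_normZ ds_norm0_eq0.

Fact ds_complete (F : set_system ds_sort) :
  ProperFilter F -> cauchy F -> cvg F.
Proof.
move=> FF /cauchy_ballP Fc.
have Fi i : cvg ((fun x : ds_sort => x i) @ F).
  apply: cauchy_cvg; apply/cauchy_ballP => e e0.
  have [[U V] /= [FU FV] UV] := Fc e e0.
  exists ((fun x : ds_sort => x i) @` U, (fun x : ds_sort => x i) @` V).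
    split; first by apply: filterS FU => x Ux; exists x.
    by apply: filterS FV => x Vx; exists x.
  move=> [_ _] /= [[x Ux <-] [y Vy <-]].
  have := UV (x, y) (conj Ux Vy); rewrite -!ball_normE /= => /le_lt_trans.
  by apply; exact: (ds_norm_ge (x - y)).
pose l : ds_sort := fun i => lim ((fun x : ds_sort => x i) @ F).
apply/cvg_ex; exists l; apply/cvgrPdist_le => e e0.
have : \forall x \near F, forall i, `|l i - x i| <= e.
  apply: filter_forall => i.
  by have /cvgrPdist_le := Fi i; apply.
apply: filterS => x xe; apply: ds_norm_le; [exact: ltW|exact: xe].
Qed.

HB.instance Definition _ := Uniform_isComplete.Build ds_sort ds_complete.

Fact ds_scalerAl (k : R[i]) x y : k *: ds_mul x y = ds_mul (k *: x) y.
Proof. by apply/functional_extensionality_dep => i; exact: cstar_scaleAl. Qed.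
Fact ds_scalerAr (k : R[i]) x y : k *: ds_mul x y = ds_mul x (k *: y).
Proof. by apply/functional_extensionality_dep => i; exact: cstar_scaleAr. Qed.
Fact ds_starD x y : ds_star (x + y) = ds_star x + ds_star y.
Proof. by apply/functional_extensionality_dep => i; exact: cstar_starD. Qed.
Fact ds_starZ (k : R[i]) x : ds_star (k *: x) = k^* *: ds_star x.
Proof. by apply/functional_extensionality_dep => i; exact: cstar_starZ. Qed.
Fact ds_starM x y : ds_star (ds_mul x y) = ds_mul (ds_star y) (ds_star x).
Proof. by apply/functional_extensionality_dep => i; exact: cstar_starM. Qed.
Fact ds_starK x : ds_star (ds_star x) = x.
Proof. by apply/functional_extensionality_dep => i; exact: cstar_starK. Qed.

Fact ds_normM_le x y : `|ds_mul x y| <= `|x| * `|y|.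
Proof.
apply: ds_norm_le => [|i]; first by rewrite mulr_ge0.
by rewrite (le_trans (cstar_normM_le _ _))// ler_pM// ds_norm_ge.
Qed.

Fact ds_cstar_norm x : `|ds_mul (ds_star x) x| = `|x| ^+ 2.
Proof.
apply/eqP; rewrite eq_le; apply/andP; split.
  apply: ds_norm_le => [|i]; first by rewrite exprn_ge0.
  by rewrite cstar_norm lerXn2r ?nnegrE// ds_norm_ge.
have {1}-> : `|ds_mul (ds_star x) x| = sqrtC `|ds_mul (ds_star x) x| ^+ 2.
  by rewrite sqrtCK.
rewrite lerXn2r ?nnegrE ?sqrtC_ge0//; apply: ds_norm_le => [|i].
  by rewrite sqrtC_ge0.
rewrite -(@ler_pXn2r _ 2) ?nnegrE ?sqrtC_ge0// sqrtCK -cstar_norm.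
exact: (ds_norm_ge (ds_mul (ds_star x) x)).
Qed.

Definition direct_sum : cstarAlgType R :=
  CStarAlg ds_mulA ds_mul1x ds_mulx1 ds_mulDl ds_mulDr ds_scalerAl ds_scalerAr
    ds_starD ds_starZ ds_starM ds_starK ds_normM_le ds_cstar_norm.

End DirectSum.

(** * States and the Rieffel metric *)

(* Functionals carry the topology of pointwise convergence; it induces the
   weak-* topology on the set of states, which is closed in it.  [R[i]^o] is
   [R[i]] as a normed module over itself. *)
Definition functional (R : realType) (A : cstarAlgType R) : Type :=
  {ptws A -> R[i]^o}.

HB.instance Definition _ (R : realType) (A : cstarAlgType R) :=
  Topological.copy (functional A) {ptws A -> R[i]^o}.
HB.instance Definition _ (R : realType) (A : cstarAlgType R) :=
  GRing.Lmodule.copy (functional A) (A -> R[i]^o).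

Section States.
Variables (R : realType) (A : cstarAlgType R).
Implicit Types (mu nu : functional A) (K : set (functional A)).

(* In [R[i]], [0 <= z] means that [z] is real and nonnegative.  Continuity and
   norm one are automatic for positive functionals with value 1 at 1. *)
Definition state_space : set (functional A) :=
  [set mu | [/\ scalar mu, forall a, 0 <= mu (star a * a) & mu 1 = 1]].

Definition closed_convex_hull K : set (functional A) :=
  smallest (fun C => closed C /\ convex_set C) K.

Variables (Lip : set A) (L : A -> R).

(* The supremum is taken in the extended reals; its finiteness is part of
   [is_lipschitz_seminorm]. *)
Definition rieffel_metric mu nu : \bar R :=
  ereal_sup [set (complex.Re `|mu a - nu a|)%:E
            | a in [set a | Lip a /\ L a <= 1]].

Definition rieffel_open (U : set (functional A)) : Prop :=
  forall mu, U mu -> exists2 e : R, 0 < e &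
    forall nu, state_space nu -> (rieffel_metric mu nu < e%:E)%E -> U nu.

(* [L] is a total function, but only its values on [Lip] matter. *)
Record is_lipschitz_seminorm : Prop := IsLipschitzSeminorm {
  lipschitz_submod : GRing.submod_closed [in Lip] ;
  lipschitz_dense : dense Lip ;
  lipschitzD : forall a b, Lip a -> Lip b -> L (a + b) <= L a + L b ;
  lipschitzZ : forall (k : R[i]) a, Lip a ->
    L (k *: a) = complex.Re `|k| * L a ;
  lipschitz_eq0 : forall a,
    (Lip a /\ L a = 0) <-> exists k : R[i], a = k *: (1 : A) ;
  rieffel_bounded : exists M : R, forall mu nu,
    state_space mu -> state_space nu -> (rieffel_metric mu nu <= M%:E)%E ;
  rieffel_weak_star : forall U, U `<=` state_space ->
    (rieffel_open U <-> exists2 W, open W & U = W `&` state_space)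
}.

End States.

Arguments state_space {R} A _.

Record is_unital_star_hom (R : realType) (A B : cstarAlgType R) (f : A -> B) :
    Prop := IsUnitalStarHom {
  star_hom_linear : linear f ;
  star_hom1 : f 1 = 1 ;
  star_homM : forall a b, f (a * b) = f a * f b ;
  star_hom_star : forall a, f (star a) = star (f a)
}.

Definition dual_map (R : realType) (A B : cstarAlgType R) (f : A -> B) :
    functional B -> functional A :=
  fun mu a => mu (f a).

(** * Noncommutative Mauldin-Williams graphs *)

Record nc_mauldin_williams (R : realType) := NCMauldinWilliams {
  vertex : finType ;
  edge : finType ;
  edge_range : edge -> vertex ;
  edge_source : edge -> vertex ;
  alg : vertex -> cstarAlgType R ;
  alg_neq0 : forall v, (1 : alg v) != 0 ;
  lip : forall v, set (alg v) ;
  lipnorm : forall v, alg v -> R ;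
  lipnormP : forall v, is_lipschitz_seminorm (@lip v) (@lipnorm v) ;
  edge_hom : forall e, alg (edge_source e) -> alg (edge_range e) ;
  edge_homP : forall e, is_unital_star_hom (@edge_hom e) ;
  edge_contraction : exists c : R, [/\ 0 < c, c < 1 &
    forall e (mu nu : functional (alg (edge_range e))),
      state_space _ mu -> state_space _ nu ->
      (rieffel_metric (@lip (edge_source e)) (@lipnorm (edge_source e))
         (dual_map (@edge_hom e) mu) (dual_map (@edge_hom e) nu)
       <= c%:E * rieffel_metric (@lip (edge_range e)) (@lipnorm (edge_range e))
                 mu nu)%E]
}.

Section MauldinWilliams.
Variables (R : realType) (M : nc_mauldin_williams R).

Definition no_sinks : Prop := forall v : vertex M, exists e, edge_source e = v.

Variable K : forall v : vertex M, set (functional (alg v)).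
Arguments K : clear implicits.

(* [edge_image v] is the union, over the edges [e] with [edge_source e = v], of
   the images of [K (edge_range e)] under the dual map of [edge_hom e]; taking
   [v] as an index of the family avoids a transport along that equality. *)
Inductive edge_image : forall v : vertex M, functional (alg v) -> Prop :=
  EdgeImage (e : edge M) (nu : functional (alg (edge_range e))) :
    K (edge_range e) nu -> edge_image (dual_map (@edge_hom R M e) nu).

Definition invariant_family : Prop :=
  forall v, [/\ K v !=set0, compact (K v), K v `<=` state_space (alg v)
    & K v = [set mu | edge_image mu]].

End MauldinWilliams.

(* Main.v *)
Require Import Defs.
From HB Require Import structures.
From mathcomp Require Import all_boot all_order all_algebra.
From mathcomp Require Import complex.
From mathcomp Require Import ring lra.
From mathcomp Require Import all_classical all_reals all_analysis.

(* Composing the dual maps along n edges contracts the Rieffel metric by c^n, so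
   a state in K_v is of the form [nu \o phi], where all states nearly agree on
   [phi a] for a Lipschitz element a.  If all states of a C*-algebra are at most
   e on b and nu b = 0, then nu (b^* b) <= 4 e^2: test the states
   x |-> nu ((1 + t b)^* x (1 + t b)), suitably normalised, for a few t.  Hence
   states in K_v have zero variance on Lipschitz elements, are therefore
   multiplicative on them, and kill their commutators.  So does the closed convex
   hull of K_v, that is, every state; and states separate points.
   The separation of points comes from the Hahn-Banach theorem and the positivity
   of a^* a (Fukamiya-Kaplansky), for which square roots of elements near 1
   replace spectral theory. *)

Set Implicit Arguments.
Unset Strict Implicit.
Unset Printing Implicit Defensive.

Import Order.TTheory GRing.Theory Num.Theory.
Import numFieldNormedType.Exports.

Local Open Scope classical_set_scope.
Local Open Scope ring_scope.
Local Open Scope complex_scope.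

(** * The real-valued norm of a C*-algebra *)

Section CstarNorm.
Context {R : realType} {A : cstarAlgType R}.
Implicit Types (x y z a b : A) (r t : R) (k : R[i]).

Definition nrm x : R := complex.Re `|x|.

Lemma nrmE x : `|x| = (nrm x)%:C.
Proof. by rewrite RRe_real// normr_real. Qed.

Lemma nrm_ge0 x : 0 <= nrm x.
Proof. by rewrite -ler0c -nrmE. Qed.

Lemma nrm0 : nrm 0 = 0.
Proof. by rewrite /nrm normr0. Qed.

Lemma nrm_eq0 x : (nrm x == 0) = (x == 0).
Proof. by rewrite -[RHS]normr_eq0 nrmE (inj_eq (@complexI _)). Qed.

Lemma nrm_le0 x : nrm x <= 0 -> x = 0.
Proof. by move=> x0; apply/eqP; rewrite -nrm_eq0 eq_le x0 nrm_ge0. Qed.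

Lemma nrmN x : nrm (- x) = nrm x.
Proof. by rewrite /nrm normrN. Qed.

Lemma nrmB x y : nrm (x - y) = nrm (y - x).
Proof. by rewrite /nrm distrC. Qed.

Lemma nrmD x y : nrm (x + y) <= nrm x + nrm y.
Proof. by rewrite -lecR rmorphD/= -!nrmE ler_normD. Qed.

Lemma nrm_triB z x y : nrm (x - y) <= nrm (x - z) + nrm (z - y).
Proof. by rewrite -{1}(subrK z x) -addrA nrmD. Qed.

Lemma nrmZ k x : nrm (k *: x) = complex.Re `|k| * nrm x.
Proof. by rewrite /nrm normrZ nrmE -[`|k| in LHS]RRe_real ?normr_real// -rmorphM. Qed.

Lemma nrmZr r x : nrm (r%:C *: x) = `|r| * nrm x.
Proof. by rewrite nrmZ normc_def/= expr0n/= addr0 sqrtr_sqr. Qed.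

Lemma nrmM x y : nrm (x * y) <= nrm x * nrm y.
Proof. by rewrite -lecR rmorphM/= -!nrmE; exact: cstar_normM_le. Qed.

Lemma cscalerAl k x y : k *: (x * y) = (k *: x) * y.
Proof. exact: cstar_scaleAl. Qed.

Lemma cscalerAr k x y : k *: (x * y) = x * (k *: y).
Proof. exact: cstar_scaleAr. Qed.

Lemma starD x y : star (x + y) = star x + star y.
Proof. exact: cstar_starD. Qed.

Lemma starZ k x : star (k *: x) = (k^* : R[i]) *: star x.
Proof. exact: cstar_starZ. Qed.

Lemma starZr r x : star (r%:C *: x) = r%:C *: star x.
Proof. by rewrite starZ conj_Creal// complex_real. Qed.

Lemma starZi x : star ('i%C *: x) = - ('i%C *: star x).
Proof. by rewrite starZ complexiE conjCi scaleNr. Qed.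

Lemma starM x y : star (x * y) = star y * star x.
Proof. exact: cstar_starM. Qed.

Lemma starK x : star (star x) = x.
Proof. exact: cstar_starK. Qed.

Lemma star0 : star (0 : A) = 0.
Proof. by apply: (@addIr _ (star (0 : A))); rewrite -starD !add0r. Qed.

Lemma starN x : star (- x) = - star x.
Proof. by apply/eqP; rewrite -subr_eq0 opprK -starD addNr star0. Qed.

Lemma starB x y : star (x - y) = star x - star y.
Proof. by rewrite starD starN. Qed.

Lemma star1 : star (1 : A) = 1.
Proof. by rewrite -[LHS]mulr1 -{2}[1]starK -starM mulr1 starK. Qed.

Lemma nrm_starM x : nrm (star x * x) = nrm x ^+ 2.
Proof.
by apply: (@complexI R); rewrite rmorphXn/= -!nrmE; exact: cstar_norm.
Qed.

Lemma nrm_star x : nrm (star x) = nrm x.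
Proof.
have le y : nrm y <= nrm (star y).
  have [y0|y0] := eqVneq (nrm y) 0; first by rewrite y0 nrm_ge0.
  rewrite -(@ler_pM2r _ (nrm y)); last by rewrite lt0r y0 nrm_ge0.
  by rewrite -expr2 -nrm_starM nrmM.
by apply/eqP; rewrite eq_le le -{2}[x]starK le.
Qed.

Lemma nrm1_le : nrm (1 : A) <= 1.
Proof.
have := nrm_starM 1; rewrite mulr1 star1 => /eqP.
rewrite eq_sym expr2 -subr_eq0 -[X in _ - X]mulr1 -mulrBr mulf_eq0.
by move=> /orP[/eqP->//|]; rewrite subr_eq0 => /eqP->.
Qed.

Lemma nrm_sq x : star x = x -> nrm (x * x) = nrm x ^+ 2.
Proof. by move=> xs; rewrite -nrm_starM xs. Qed.

Lemma comm_scale k x z : GRing.comm x z -> GRing.comm (k *: x) z.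
Proof. by rewrite /GRing.comm -cscalerAl -cscalerAr => ->. Qed.

(** Completeness with a rate: the Cauchy modulus [e] survives as an error bound for the limit, so
    identities between limits can be checked up to a multiple of [e n]. *)
Lemma cvg_of_nrm_cauchy (w : nat -> A) (e : nat -> R) :
  (forall m n, (m <= n)%N -> nrm (w n - w m) <= e m) ->
  e @ \oo --> 0 ->
  exists l, forall n, nrm (l - w n) <= e n.
Proof.
move=> we e0.
have : cvg (w @ \oo).
  apply: cauchy_cvg; apply/cauchy_ballP => d d0.
  have dE : d = (complex.Re d)%:C by rewrite RRe_real// gtr0_real.
  have d0' : 0 < complex.Re d by rewrite -ltcR -dE.
  have /cvgrPdist_lt/(_ _ (divr_gt0 d0' (ltr0n _ 2)))[N _ Ne] := e0.
  have eN : e N < complex.Re d / 2.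
    by have := Ne N (leqnn N); rewrite sub0r normrN; apply: le_lt_trans; exact: ler_norm.
  exists ([set w n | n in [set n | (N <= n)%N]], [set w n | n in [set n | (N <= n)%N]]).
    by split; exists N => // n Nn; exists n.
  move=> [_ _] /= [[m Nm <-] [n Nn <-]]; rewrite -ball_normE /=.
  rewrite nrmE dE ltcR (le_lt_trans (nrm_triB (w N) _ _))// (splitr (complex.Re d)).
  by rewrite ltrD// (le_lt_trans _ eN)// ?we// nrmB we.
move=> /cvg_ex[l wl]; exists l => n; apply/ler_addgt0Pr => d d0.
have d0' : 0 < d%:C by rewrite ltcR.
have /cvgrPdist_lt/(_ _ d0')[N _ Nl] := wl.
have := Nl (maxn n N) (leq_maxr _ _); rewrite nrmE ltcR => /ltW lw.
by rewrite (le_trans (nrm_triB (w (maxn n N)) _ _))// addrC lerD// we// leq_maxl.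
Qed.

End CstarNorm.

(** * Square roots *)

Lemma le0_cvg0 {R : realType} (x C : R) (e : nat -> R) :
  e @ \oo --> 0 -> (forall n, x <= C * e n) -> x <= 0.
Proof.
move=> e0 xC; have : (fun n => C * e n) @ \oo --> C * 0 by exact: cvgMr.
rewrite mulr0 => h; rewrite -(cvg_lim (@Rhausdorff R) h).
apply: limr_ge; first by apply/cvg_ex; exists 0.
by near=> n; exact: xC.
Unshelve. all: by end_near. Qed.

Section SquareRoot.
Context {R : realType} {A : cstarAlgType R}.
Implicit Types (x y z a b : A) (r t : R).

(* A fixed point [w] of [w |-> (y + w^2) / 2] satisfies [(1 - w)^2 = 1 - y]; the
   iterates and their increments are dominated by those of the scalar case [y = 1]. *)
Fixpoint sqrt_iter y n : A :=
  if n is m.+1 then 2^-1%:C *: (y + sqrt_iter y m * sqrt_iter y m) else 0.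

Fixpoint sqrt_majorant n : R :=
  if n is m.+1 then 2^-1 * (1 + sqrt_majorant m ^+ 2) else 0.

(** The gap [g] to the fixed point 1 evolves by [g - g^2 / 2], hence decays like [2 / n]. *)
Lemma sqrt_majorant_bounds n :
  [/\ 0 <= sqrt_majorant n, sqrt_majorant n <= 1,
      sqrt_majorant n <= sqrt_majorant n.+1 &
      1 - sqrt_majorant n <= 2 * n.+2%:R^-1].
Proof.
have : [/\ 0 <= sqrt_majorant n, sqrt_majorant n <= 1 &
      1 - sqrt_majorant n <= 2 * n.+2%:R^-1].
  elim: n => [|n [u0 u1 un]] /=; first by split; rewrite ?subr0 ?ler01// divff.
  split; [nra|nra|].
  set u := sqrt_majorant n in u0 u1 un *.
  have -> : n.+3%:R = n.+2%:R + 1 :> R by rewrite -natr1.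
  have m2 : (2 : R) <= n.+2%:R by rewrite ler_nat.
  set m : R := n.+2%:R in un m2 *.
  have m0 : m != 0 by apply/eqP => E; move: m2; rewrite E; lra.
  have {un} : 1 - u <= 2 / m by [].
  set e := 2 / m => un.
  have em : e * m = 2 by rewrite /e -mulrA mulVf ?mulr1.
  rewrite ler_pdivlMr; last by lra.
  have e1 : e <= 1 by rewrite /e ler_pdivrMr; lra.
  have e0 : 0 <= e by rewrite /e divr_ge0//; lra.
  have h : 1 - 2^-1 * (1 + u ^+ 2) <= e - e ^+ 2 / 2 by nra.
  apply: (@le_trans _ _ ((e - e ^+ 2 / 2) * (m + 1))).
    by rewrite ler_wpM2r//; lra.
  (* As [e * m = 2], this equals [2 - e^2 / 2]. *)
  have -> : (e - e ^+ 2 / 2) * (m + 1) = (e * m) * (1 - e / 2) + (e - e ^+ 2 / 2).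
    by field.
  rewrite em.
  nra.
move=> [u0 u1 un]; split=> //=; nra.
Qed.

Lemma sqrt_iterP y : star y = y -> nrm y <= 1 -> forall n,
  [/\ star (sqrt_iter y n) = sqrt_iter y n,
      forall z, GRing.comm y z -> GRing.comm (sqrt_iter y n) z &
      nrm (sqrt_iter y n) <= sqrt_majorant n].
Proof.
move=> ys y1; elim=> [|n [ws wc wn]] /=.
  by split=> [|z _|]; rewrite ?star0 ?nrm0//; apply: commr_sym; exact: commr0.
split.
- by rewrite starZr starD starM ws ys.
- move=> z yz; apply: comm_scale; apply: commr_sym.
  by apply: commrD; [|apply: commrM]; apply: commr_sym => //; exact: wc.
- rewrite nrmZr ger0_norm// ler_wpM2l// (le_trans (nrmD _ _))// lerD//.
  by rewrite (le_trans (nrmM _ _))// expr2 ler_pM// nrm_ge0.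
Qed.

(** Consecutive iterates commute, so an increment is half the product of the previous difference and
    sum, each dominated by its scalar counterpart. *)
Lemma sqrt_iter_step y n : star y = y -> nrm y <= 1 ->
  nrm (sqrt_iter y n.+1 - sqrt_iter y n) <=
  sqrt_majorant n.+1 - sqrt_majorant n.
Proof.
move=> ys y1; have wP := sqrt_iterP ys y1.
elim: n => [|n IH].
  rewrite /= mulr0 addr0 !subr0 nrmZr ger0_norm// expr0n/= addr0 mulr1.
  by rewrite ler_piMr.
have [_ wc wn] := wP n; have [_ _ wn1] := wP n.+1.
have cy : GRing.comm y (sqrt_iter y n) by apply: commr_sym; exact: wc.
have [_ wc1 _] := wP n.+1.
have cw := wc1 _ cy.
set a := sqrt_iter y n.+1 in IH wn1 cw *; set b := sqrt_iter y n in IH wn cw *.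
have -> : sqrt_iter y n.+2 - a = 2^-1%:C *: ((a - b) * (a + b)).
  rewrite /= -/a {2}/a /= -/b -scalerBr opprD addrACA subrr add0r.
  by rewrite mulrDr !mulrBl -cw addrA subrK.
have -> : sqrt_majorant n.+2 - sqrt_majorant n.+1 =
  2^-1 * ((sqrt_majorant n.+1 - sqrt_majorant n) * (sqrt_majorant n.+1 + sqrt_majorant n)).
  by rewrite /=; field.
rewrite nrmZr ger0_norm// ler_wpM2l// (le_trans (nrmM _ _))//.
by rewrite ler_pM ?nrm_ge0// (le_trans (nrmD _ _))// lerD.
Qed.

(** The root is [1 - l] for the limit [l] of the iterates. The bound on [1 - s] is recorded because
    it exhibits [s] itself as positive. *)
Lemma sqrt_one_sub y : star y = y -> nrm y <= 1 ->
  exists s, [/\ star s = s, s * s = 1 - y, nrm (1 - s) <= 1 &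
    forall z, GRing.comm y z -> GRing.comm s z].
Proof.
move=> ys y1; have wP := sqrt_iterP ys y1.
pose w := sqrt_iter y.
(* The increments telescope against those of the majorant, whose distance to 1 is at most
   [2 / (m + 2)]. *)
have cau m n : (m <= n)%N -> nrm (w n - w m) <= 2 * harmonic m.
  move=> mn; have [_ _ _ um] := sqrt_majorant_bounds m.
  apply: (@le_trans _ _ (1 - sqrt_majorant m)); last first.
    by rewrite (le_trans um)// ler_pM2l// lef_pV2 ?posrE// ler_nat.
  apply: (@le_trans _ _ (sqrt_majorant n - sqrt_majorant m)); last first.
    by rewrite lerB//; have [] := sqrt_majorant_bounds n.
  rewrite -(subnK mn); elim: (n - m)%N => [|k IH].
    by rewrite add0n !subrr nrm0.
  rewrite addSn (le_trans (nrm_triB (w (k + m)%N) _ _))//.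
  rewrite -[X in _ <= X - _](subrK (sqrt_majorant (k + m))) -addrA lerD//.
  exact: sqrt_iter_step.
have [l lw] : exists l, forall n, nrm (l - w n) <= 2 * harmonic n.
  apply: cvg_of_nrm_cauchy => //; rewrite -[X in _ --> X](mulr0 (2 : R)).
  by apply: cvgMr; exact: cvg_harmonic.
have limE x C : (forall n, nrm x <= C * harmonic n) -> x = 0.
  by move=> h; apply: nrm_le0; exact: le0_cvg0 (@cvg_harmonic R) h.
have w1 n : nrm (w n) <= 1.
  have [_ _ wn] := wP n; rewrite (le_trans wn)//.
  by have [] := sqrt_majorant_bounds n.
have l1 : nrm l <= 1.
  rewrite -subr_le0; apply: (@le0_cvg0 _ _ 2 _ (@cvg_harmonic R)) => n.
  by rewrite lerBlDr -(subrK (w n) l) (le_trans (nrmD _ _))// lerD.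
have ls : star l = l.
  apply/subr0_eq; apply: (limE _ 4) => n; have ws : star (w n) = w n by case: (wP n).
  rewrite (le_trans (nrm_triB (w n) _ _))//.
  rewrite -{1}ws -starB nrm_star (nrmB (w n)).
  by rewrite (le_trans (lerD (lw n) (lw n)))// -mulrDl -natrD.
have lc z : GRing.comm y z -> GRing.comm l z.
  move=> yz; apply/subr0_eq; apply: (limE _ (4 * nrm z)) => n.
  have [_ wc _] := wP n; have {}wc : w n * z = z * w n := wc _ yz.
  have -> : l * z - z * l = (l - w n) * z - z * (l - w n).
    by rewrite mulrBl mulrBr wc opprB addrA subrK.
  rewrite (le_trans (nrmD _ _))// nrmN.
  apply: (@le_trans _ _ ((2 * harmonic n) * nrm z + nrm z * (2 * harmonic n))).
    by rewrite lerD// (le_trans (nrmM _ _))// ?ler_wpM2r ?ler_wpM2l ?nrm_ge0.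
  by rewrite le_eqVlt; apply/orP; left; apply/eqP; ring.
(* The recursion passes to the limit; the four error terms below are each at most
   [2 * harmonic n]. *)
have ll : l + l = y + l * l.
  apply/subr0_eq; apply: (limE _ 8) => n.
  have lw1 := lw n.+1.
  have wE : w n.+1 + w n.+1 = y + w n * w n.
    have h2 : 2^-1 + 2^-1 = 1 :> R by lra.
    by rewrite /w /= -scalerDl -rmorphD/= h2 scale1r.
  have -> : l + l - (y + l * l) =
    ((l - w n.+1) + (l - w n.+1)) + (w n * (w n - l) + (w n - l) * l).
    rewrite (addrACA l) -opprD wE mulrBl mulrBr subrKA.
    by rewrite -!addrA; congr (_ + (_ + _)); rewrite !opprD -!addrA addKr.
  rewrite (le_trans (nrmD _ _))//.
  have h1 : harmonic n.+1 <= harmonic n :> R.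
    by rewrite lef_pV2 ?posrE// ler_nat.
  have -> : 8 * harmonic n = 4 * harmonic n + 4 * harmonic n :> R by ring.
  apply: lerD; rewrite (le_trans (nrmD _ _))//.
    apply: (@le_trans _ _ (2 * harmonic n.+1 + 2 * harmonic n.+1)); first exact: lerD.
    by lra.
  have lwn := lw n; rewrite nrmB in lwn.
  have -> : 4 * harmonic n = 1 * (2 * harmonic n) + (2 * harmonic n) * 1 :> R by ring.
  by rewrite lerD// (le_trans (nrmM _ _))// ler_pM// nrm_ge0.
exists (1 - l); split.
- by rewrite starB star1 ls.
- have e : l * l = l + l - y by rewrite ll addrC addKr.
  rewrite mulrBr !mulrBl !mulr1 mul1r e opprB -addrA; congr (_ + _).
  by rewrite -!addrA addKr addrC subrK.
- by rewrite subKr.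
- move=> z yz; apply: commr_sym; apply: commrB; first exact: commr1.
  by apply: commr_sym; exact: lc.
Qed.

End SquareRoot.

(** * The positive cone *)

Section PositiveCone.
Context {R : realType} {A : cstarAlgType R}.
Implicit Types (x y z a b c d h : A) (r t e : R).

Local Notation cst t := (t%:C *: (1 : A)).

(** Positivity without spectra: for self-adjoint [x] the inequality says that the spectrum lies in
    [[0, 2 t]]. Closure under sums becomes the triangle inequality. *)
Definition cpos x : Prop :=
  star x = x /\ exists2 t : R, 0 <= t & nrm (cst t - x) <= t.

Lemma nrm_subscalar_weaken t t' x :
  t <= t' -> nrm (cst t - x) <= t -> nrm (cst t' - x) <= t'.
Proof.
move=> tt' xt; have -> : cst t' - x = cst (t' - t) + (cst t - x).
  by rewrite addrA -scalerDl -rmorphD/= subrK.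
rewrite (le_trans (nrmD _ _))// -[leRHS](subrK t) lerD// nrmZr ger0_norm ?subr_ge0//.
by rewrite ler_piMr ?subr_ge0// nrm1_le.
Qed.

Lemma cposD x y : cpos x -> cpos y -> cpos (x + y).
Proof.
move=> [xs [t t0 xt]] [ys [r r0 yr]]; split; first by rewrite starD xs ys.
exists (t + r); first exact: addr_ge0.
by rewrite rmorphD scalerDl opprD addrACA (le_trans (nrmD _ _))// lerD.
Qed.

Lemma cposZ r x : 0 <= r -> cpos x -> cpos (r%:C *: x).
Proof.
move=> r0 [xs [t t0 xt]]; split; first by rewrite starZr xs.
exists (r * t); first exact: mulr_ge0.
by rewrite rmorphM/= -scalerA -scalerBr nrmZr ger0_norm// ler_wpM2l.
Qed.

(** Rescaling makes [1 - x / t] of norm at most 1, where [t0] is enlarged to allow the division; the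
    root of [x / t] is then multiplied by the root of [t]. *)
Lemma cpos_sqrt x : cpos x -> exists s, [/\ star s = s, s * s = x, cpos s &
  forall z, GRing.comm x z -> GRing.comm s z].
Proof.
move=> [xs [t0 t0_ge0 xt0]]; pose t := t0 + 1.
have t_gt0 : 0 < t by rewrite ltr_wpDl.
have t_ge0 := ltW t_gt0.
have {xt0} xt : nrm (cst t - x) <= t.
  by apply: nrm_subscalar_weaken xt0; rewrite lerDl.
have tV : t%:C * t^-1%:C = 1 by rewrite -rmorphM/= mulfV ?gt_eqF.
pose y := 1 - t^-1%:C *: x.
have ys : star y = y by rewrite starB star1 starZr xs.
have y1 : nrm y <= 1.
  have -> : y = t^-1%:C *: (cst t - x).
    by rewrite scalerBr scalerA mulrC tV scale1r.
  by rewrite nrmZr ger0_norm ?invr_ge0// ler_pdivrMl// mulr1.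
have [s [ss sE s1 sc]] := sqrt_one_sub ys y1.
have u0 : 0 <= Num.sqrt t by exact: sqrtr_ge0.
exists ((Num.sqrt t)%:C *: s); split.
- by rewrite starZr ss.
- rewrite -cscalerAl -cscalerAr scalerA sE -rmorphM/= -expr2 sqr_sqrtr//.
  by rewrite subKr scalerA tV scale1r.
- apply: cposZ => //; split=> //; exists 1 => //.
  by rewrite scale1r.
- move=> z xz; apply: comm_scale; apply: sc; apply: commr_sym.
  apply: commrB; first exact: commr1.
  by apply: commr_sym; exact: comm_scale.
Qed.

(* [c * c + d * d] is [u^* u] for [u = c + i d], and [c] is the real part of [u]. *)
Lemma nrm_sq_le_sum c d : star c = c -> star d = d -> GRing.comm c d ->
  nrm (c * c) <= nrm (c * c + d * d).
Proof.
move=> cs ds cd; pose u := c + 'i%C *: d.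
have us : star u = c - 'i%C *: d by rewrite starD starZi cs ds.
have uE : star u * u = c * c + d * d.
  rewrite us mulrDr !mulrBl -cscalerAl -!cscalerAr -cscalerAl cd addrA subrK.
  have ii : 'i%C * 'i%C = -1 :> R[i] by rewrite -expr2 sqr_i.
  by rewrite scalerA ii scaleN1r opprK.
rewrite -uE nrm_starM nrm_sq// lerXn2r ?nnegrE ?nrm_ge0//.
have cE : c = 2^-1%:C *: (u + star u).
  rewrite us addrACA subrr addr0 -mulr2n -[c *+ 2]scaler_nat scalerA.
  suff -> : 2^-1%:C * 2%:R = 1 :> R[i] by rewrite scale1r.
  by rewrite -(rmorph_nat (real_complex R)) -rmorphM mulVf ?rmorph1// pnatr_eq0.
rewrite {1}cE nrmZr ger0_norm// ler_pdivrMl// mulr_natl mulr2n.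
by rewrite (le_trans (nrmD _ _))// nrm_star.
Qed.

Lemma cpos0 : cpos 0.
Proof. by split; rewrite ?star0//; exists 0; rewrite // subr0 scale0r nrm0. Qed.

(* For [|s| <= 1] and [c ^ 2 = 1 - s ^ 2], the identity
   [(1 - 2 s^2)^2 + (2 s c)^2 = 1] plays the role of [cos^2 + sin^2 = 1]. *)
Lemma cpos_sq s : star s = s -> cpos (s * s).
Proof.
have small x : star x = x -> nrm x <= 1 -> cpos (x * x).
  move=> xs x1; set y := x * x.
  have ys : star y = y by rewrite starM xs.
  have y1 : nrm y <= 1 by rewrite nrm_sq// exprn_ile1 ?nrm_ge0.
  have [c [cs cE _ cc]] := sqrt_one_sub ys y1.
  have xc : GRing.comm x c.
    by apply: commr_sym; apply: cc; rewrite /GRing.comm /y mulrA.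
  pose p := x * c.
  have pE : p * p = y - y * y.
    by rewrite /p mulrA -(mulrA x c) -xc mulrA -mulrA cE mulrBr mulr1.
  have yx : GRing.comm y x by rewrite /GRing.comm /y mulrA.
  have yc : GRing.comm y c by apply: commr_sym; apply: cc.
  have yp : GRing.comm y p by apply: commrM.
  have ps : star p = p by rewrite starM xs cs; exact: esym xc.
  have sum1 : (1 - y *+ 2) * (1 - y *+ 2) + (p *+ 2) * (p *+ 2) = 1.
    have -> : (p *+ 2) * (p *+ 2) = y *+ 2 + y *+ 2 - (y *+ 2) * (y *+ 2).
      by rewrite !mulrnAl !mulrnAr -!mulrnA pE mulrnBl -mulrnDr.
    rewrite mulrBr mulr1 mulrBl mul1r opprB -addrA.
    by rewrite -(addrA (y *+ 2)) subrKA (addrC (_ * _)) subrK subrK.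
  have /nrm_sq_le_sum : star (1 - y *+ 2) = 1 - y *+ 2.
    by rewrite mulr2n starB star1 starD ys.
  move=> /(_ (p *+ 2)); rewrite sum1 => h.
  have {h} y2 : nrm (1 - y *+ 2) <= 1.
    rewrite -(@ler_pXn2r _ 2) ?nnegrE ?nrm_ge0// expr1n -nrm_sq; last first.
      by rewrite mulr2n starB star1 starD ys.
    rewrite (le_trans (h _ _)) ?nrm1_le//; first by rewrite mulr2n starD ps.
    apply: commr_sym; apply: commrB; first exact: commr1.
    by apply: commrMn; apply: commr_sym; apply: commrMn.
  split=> //; exists 2^-1 => //.
  have -> : cst 2^-1 - y = 2^-1%:C *: (1 - y *+ 2).
    rewrite scalerBr -[y *+ 2]scaler_nat scalerA.
    suff -> : 2^-1%:C * 2%:R = 1 :> R[i] by rewrite scale1r.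
    by rewrite -(rmorph_nat (real_complex R)) -rmorphM mulVf ?rmorph1// pnatr_eq0.
  by rewrite nrmZr ger0_norm// ler_piMr.
move=> ss; have [s0|s0] := eqVneq (nrm s) 0.
  by move/eqP: s0; rewrite nrm_eq0 => /eqP->; rewrite mul0r; exact: cpos0.
have sE : s = (nrm s)%:C *: ((nrm s)^-1%:C *: s).
  by rewrite scalerA -rmorphM mulfV// scale1r.
rewrite sE -cscalerAl -cscalerAr scalerA -rmorphM.
apply: cposZ; first by rewrite mulr_ge0 ?nrm_ge0.
apply: small; first by rewrite starZr ss.
by rewrite nrmZr ger0_norm ?invr_ge0 ?nrm_ge0// mulVf.
Qed.

(** The case [e = 0] is antisymmetry of the order; general [e] serves elements of known sign up to a
    small scalar. The roots of [e - h] and [e + h] commute and their squares add up to [2 e], which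
    bounds [e - h]. *)
Lemma cpos_antisym e h : 0 <= e ->
  cpos (cst e - h) -> cpos (cst e + h) -> nrm h <= 3 * e.
Proof.
move=> e0 P1 P2.
have [c [cs cE _ cc]] := cpos_sqrt P1.
have [d [ds dE _ dc]] := cpos_sqrt P2.
have hc : GRing.comm (cst e) h by apply: comm_scale; exact: (commr_sym (commr1 _)).
have cd : GRing.comm c d.
  apply: cc; apply: commr_sym; apply: dc.
  apply: commrB.
    by apply: commr_sym; apply: comm_scale; exact: (commr_sym (commr1 _)).
  by apply: commr_sym; apply: commrD; [exact: commr_sym|exact: commr_refl].
have := nrm_sq_le_sum cs ds cd; rewrite cE dE addrACA addNr addr0 -scalerDl -rmorphD/=.
rewrite nrmZr ger0_norm ?addr_ge0// => eh.
have h2 : nrm (cst e - h) <= 2 * e.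
  rewrite (le_trans eh)// [leRHS]mulr_natl mulr2n ler_piMr ?addr_ge0//; exact: nrm1_le.
rewrite -(subKr (cst e) h) (le_trans (nrmD _ _))// nrmN nrmZr ger0_norm//.
have n1 := @nrm1_le R A; nra.
Qed.

(* With [y = b^* b] and [z = b b^*], [(t - y)^n b^* = b^* (t - z)^n] bounds
   [(t - y)^n] by [t^n] up to a factor linear in [n], which the identity
   [|g^2| = |g|^2] turns into [|t - y| <= t]. *)
Lemma cpos_flip b : cpos (b * star b) -> cpos (star b * b).
Proof.
move=> [_ [t0 t0_ge0 zt0]]; split; first by rewrite starM starK.
pose t := t0 + 1.
have t_gt0 : 0 < t by rewrite ltr_wpDl.
have t_ge0 := ltW t_gt0.
have {zt0} zt : nrm (cst t - b * star b) <= t.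
  by apply: nrm_subscalar_weaken zt0; rewrite lerDl.
exists t => //.
set y := star b * b; set z := b * star b in zt.
pose g := cst t - y; pose k := cst t - z.
have gs : star g = g by rewrite starB starZr star1 starM starK.
have gb1 : g * star b = star b * k.
  by rewrite /g /k mulrBl mulrBr -cscalerAl -cscalerAr mul1r mulr1 /y mulrA.
have gb n : g ^+ n * star b = star b * k ^+ n.
  elim: n => [|n IH]; first by rewrite !expr0 mul1r mulr1.
  by rewrite !exprSr -mulrA gb1 mulrA IH mulrA.
pose N := nrm b ^+ 2.
have kn n : nrm (k ^+ n) <= t ^+ n.
  elim: n => [|n IH]; first by rewrite !expr0 nrm1_le.
  by rewrite !exprS (le_trans (nrmM _ _))// ler_pM// nrm_ge0.
have N0 : 0 <= N by rewrite sqr_ge0.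
have gy n : nrm (g ^+ n * y) <= N * t ^+ n.
  rewrite /y mulrA gb (le_trans (nrmM _ _))// /N.
  have -> : nrm b ^+ 2 * t ^+ n = (nrm b * t ^+ n) * nrm b by ring.
  rewrite ler_wpM2r ?nrm_ge0// (le_trans (nrmM _ _))// nrm_star ler_wpM2l//.
  exact: nrm_ge0.
(* Each step [t g ^+ n - g ^+ n * y] adds at most [N * t ^+ n], whence a factor linear in [n]. *)
have gn n : nrm (g ^+ n) * t <= t ^+ n * (t + n%:R * N).
  elim: n => [|n IH].
    by rewrite !expr0 mul0r addr0 ler_wpM2r// nrm1_le.
  have -> : g ^+ n.+1 = t%:C *: g ^+ n - g ^+ n * y.
    by rewrite exprSr {2}/g mulrBr -cscalerAr mulr1.
  have h : nrm (t%:C *: g ^+ n - g ^+ n * y) <= t * nrm (g ^+ n) + N * t ^+ n.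
    by rewrite (le_trans (nrmD _ _))// nrmN nrmZr ger0_norm// lerD.
  apply: (le_trans (ler_wpM2r t_ge0 h)); rewrite exprS -natr1 mulrDl.
  have := ler_wpM2l t_ge0 IH; set T := t ^+ n; set n' := n%:R => IHt.
  lra.
have g2 n : nrm (g ^+ (2 ^ n)) = nrm g ^+ (2 ^ n).
  elim: n => [|n IH]; first by rewrite !expr1.
  rewrite expnS mul2n -addnn !exprD nrm_sq ?IH ?expr2// => {IH}.
  by elim: (2 ^ n)%N => [|m IH]; rewrite ?expr0 ?star1// {1}exprSr exprS starM gs IH.
rewrite leNgt; apply/negP => tg.
pose r := nrm g / t - 1.
have r0 : 0 < r by rewrite subr_gt0 ltr_pdivlMr ?mul1r.
have gE : nrm g = t * (1 + r) by rewrite /r addrC subrK mulrC divfK ?gt_eqF.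
(* At exponent [2 m] with [m = 2 ^ n], Bernoulli makes the left side grow at least like [m^2 r^2],
   while the right side is linear in [m]. Dividing by [m] bounds [m] itself, which is absurd for
   large [n]. *)
have bnd n : (2 ^ n)%:R * r ^+ 2 * t <= t + N * 2.
  have h := gn (2 ^ n.+1)%N.
  rewrite g2 gE exprMn -mulrA ler_pM2l ?exprn_gt0// in h.
  move: h; rewrite expnS mul2n -addnn exprD natrD.
  set m := (2 ^ n)%N => h.
  have b1 : 1 + m%:R * r <= (1 + r) ^+ m.
    elim: m {h} => [|m IH]; first by rewrite expr0 mul0r addr0.
    have m0 : 0 <= m%:R :> R by [].
    rewrite exprS -natr1; nra.
  have m1 : 1 <= m%:R :> R by rewrite ler1n expn_gt0.
  have mr0 : 0 <= m%:R * r by rewrite mulr_ge0 ?ltW// (lt_le_trans _ m1).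
  have : (m%:R * r) ^+ 2 <= (1 + r) ^+ m * (1 + r) ^+ m by nra.
  set M := m%:R in m1 mr0 b1 h *; set q := (1 + r) ^+ m in b1 h *; move=> qq.
  have : M * (M * r ^+ 2 * t) <= M * (t + N * 2).
    have := ler_wpM2r t_ge0 qq; nra.
  by rewrite ler_pM2l// (lt_le_trans _ m1).
have rt0 : 0 < r ^+ 2 * t by rewrite mulr_gt0// exprn_gt0.
have := truncnS_gt ((t + N * 2) / (r ^+ 2 * t)); set n := (Num.trunc _).+1 => nP.
have := bnd n; rewrite -mulrA -ler_pdivlMr// => /le_lt_trans/(_ nP).
by rewrite ltr_nat ltnNge ltnW// ltn_expl.
Qed.

End PositiveCone.

(** * Positivity of [a^* a] *)

Section Fukamiya.
Context {R : realType} {A : cstarAlgType R}.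
Implicit Types (x y z a b c d h : A) (r t e : R).
Local Notation cst t := (t%:C *: (1 : A)).

Lemma scale_half_addrr x : 2^-1%:C *: (x + x) = x.
Proof.
rewrite scalerDr -scalerDl -rmorphD/=.
have -> : 2^-1 + 2^-1 = 1 :> R by lra.
by rewrite scale1r.
Qed.

Lemma cpos_half x : cpos (x + x) -> cpos x.
Proof. by move=> xx; rewrite -(scale_half_addrr x); apply: cposZ. Qed.

(** Up to a factor, [p] and [q] are the real and imaginary parts of [b], and their squares add up to
    twice the element. *)
Lemma cpos_starM_add_Mstar b : cpos (star b * b + b * star b).
Proof.
pose p := b + star b; pose q := 'i%C *: (b - star b).
have ps : star p = p by rewrite starD starK addrC.
have qs : star q = q by rewrite starZi starB starK -scalerN opprB.
have ii : 'i%C * 'i%C = -1 :> R[i] by rewrite -expr2 sqr_i.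
apply: cpos_half; suff <- : p * p + q * q =
  star b * b + b * star b + (star b * b + b * star b).
  by apply: cposD; apply: cpos_sq.
rewrite -cscalerAl -cscalerAr scalerA ii scaleN1r /p.
rewrite mulrDr mulrBr !mulrBl !mulrDl.
set x := b * b; set y := star b * b; set z := b * star b; set w := star b * star b.
have -> : - (x - y - (z - w)) = y - x + (z - w) by rewrite opprD opprK opprB.
rewrite addrACA [x + y + _]addrC subrKA [z + w + _]addrC (addrC z w) subrKA.
by rewrite addrACA.
Qed.

(** Adding [- star b * b] to the previous sum shows that [b * star b] is positive, hence so is
    [star b * b]; antisymmetry concludes. *)
Lemma eq0_of_cpos_opp b : cpos (- (star b * b)) -> b = 0.
Proof.
move=> nb; have Pbb : cpos (star b * b).
  apply: cpos_flip; rewrite -[b * star b](addKr (star b * b)).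
  by apply: cposD => //; exact: cpos_starM_add_Mstar.
have := @cpos_antisym _ _ 0 (star b * b) (lexx _).
rewrite scale0r sub0r add0r mulr0 => /(_ nb Pbb); rewrite nrm_starM => b0.
apply/eqP; rewrite -nrm_eq0 -sqrf_eq0 eq_le b0; exact: sqr_ge0.
Qed.

(* With [x = a^* a], [r = |x|] and [q = r - x] (twice the negative part of [x]),
   [(a q)^* (a q) = q x q = - q^3 / 2] is the opposite of a square, so [q = 0]. *)
Lemma cpos_starM a : cpos (star a * a).
Proof.
set x := star a * a; have xs : star x = x by rewrite starM starK.
have [r [rs rE Pr rc]] := cpos_sqrt (cpos_sq xs).
have rx : GRing.comm r x by apply: rc; rewrite /GRing.comm mulrA.
have [k [ks kE _ kc]] := cpos_sqrt Pr.
have kx : GRing.comm k x by apply: kc.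
have kr : GRing.comm k r by apply: kc; exact: commr_refl.
pose q := r - x.
have qs : star q = q by rewrite starB rs xs.
have qk : GRing.comm q k by apply: commr_sym; apply: commrB.
have qx : x * q = - (r * q).
  apply/eqP; rewrite -addr_eq0 /q !mulrBr rE rx -[x * r]rx rx.
  by rewrite addrC subrKA subrr.
have rq : r * q + r * q = q * q.
  rewrite {3}/q mulrBl qx opprK; congr (_ + _).
have qks : star (q * k) = q * k by rewrite starM qs ks.
(* [q x q = - q r q], and the root [k] of [r] turns [q r q] into the square of [q k]. *)
have e1 : star (a * q) * (a * q) = - ((q * k) * (q * k)).
  rewrite starM qs -mulrA (mulrA (star a)) -/x qx mulrN; congr (- _).
  by rewrite -[r]kE (mulrA q) (mulrA q) -(mulrA (q * k)) -qk.
have qk0 : q * k = 0.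
  have : a * q = 0.
    by apply: eq0_of_cpos_opp; rewrite e1 opprK; exact: cpos_sq.
  move=> aq; move: e1; rewrite aq mulr0 => /esym/eqP.
  rewrite oppr_eq0 -nrm_eq0 nrm_sq// sqrf_eq0 nrm_eq0 => /eqP//.
(* [q^2 = 2 r q = 2 k k q], and [k q = q k = 0]. *)
have q0 : q = 0.
  apply/eqP; rewrite -nrm_eq0 -sqrf_eq0 -nrm_sq// -rq -kE -mulrA -qk qk0.
  by rewrite mulr0 addr0 nrm0.
have -> : x = r by apply/esym/eqP; rewrite -subr_eq0; apply/eqP.
exact: Pr.
Qed.

End Fukamiya.

(** * The Hahn-Banach theorem *)

Section HahnBanach.
Context {R : realType} {V : lmodType R}.
Implicit Types (p q : V -> R) (x y v : V) (r s : R).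

Definition sublinear p : Prop :=
  (forall x y, p (x + y) <= p x + p y) /\
  (forall r x, 0 <= r -> p (r *: x) = r * p x).

Lemma sublinearI p : (forall x y, p (x + y) <= p x + p y) -> p 0 = 0 ->
  (forall r x, 0 < r -> p (r *: x) <= r * p x) -> sublinear p.
Proof.
move=> pD p0 pZ; split=> // r x; rewrite le_eqVlt => /orP[/eqP<-|r0].
  by rewrite scale0r mul0r.
apply/eqP; rewrite eq_le pZ//= -ler_pdivlMl// -[x in p x <= _](scalerK (lt0r_neq0 r0)).
by apply: pZ; rewrite invr_gt0.
Qed.

Lemma sublinear0 p : sublinear p -> p 0 = 0.
Proof. by move=> [_ pZ]; rewrite -(scale0r 0) pZ// mul0r. Qed.

Lemma sublinear_ge p x : sublinear p -> - p (- x) <= p x.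
Proof.
move=> ps; have [pD _] := ps; rewrite lerNl -subr_ge0 opprK -(sublinear0 ps).
by rewrite -(addNr x) pD.
Qed.

(* A minimal sublinear functional [q] equals [sub_shift q v] for every [v], which
   is additivity of [q]; starting below [sub_shift p v] forces [f v = p v]. *)
Definition sub_shift q v x : R :=
  inf [set q (x + s *: v) - s * q v | s in [set s | 0 <= s]].

Section Shift.
Context {q : V -> R} {v : V}.
Hypothesis qs : sublinear q.

Lemma sub_shift_has_inf x :
  has_inf [set q (x + s *: v) - s * q v | s in [set s | 0 <= s]].
Proof.
split; first by exists (q (x + 0 *: v) - 0 * q v), 0 => //=.
exists (- q (- x)) => _ [s /= s0 <-]; have [qD qZ] := qs.
have := qD (x + s *: v) (- x); rewrite addrAC subrr add0r qZ//; lra.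
Qed.

Lemma sub_shift_le s x : 0 <= s -> sub_shift q v x <= q (x + s *: v) - s * q v.
Proof.
by move=> s0; apply: ge_inf; [case: (sub_shift_has_inf x)|exists s].
Qed.

Lemma sub_shift_ge x c :
  (forall s, 0 <= s -> c <= q (x + s *: v) - s * q v) -> c <= sub_shift q v x.
Proof.
move=> h; apply: lb_le_inf; first by case: (sub_shift_has_inf x).
by move=> _ [s /= s0 <-]; exact: h.
Qed.

Lemma sub_shift_le_id x : sub_shift q v x <= q x.
Proof.
by rewrite (le_trans (sub_shift_le x (lexx _)))// scale0r addr0 mul0r subr0.
Qed.

Lemma sub_shift_opp : sub_shift q v (- v) <= - q v.
Proof.
rewrite (le_trans (sub_shift_le _ ler01))// scale1r mul1r addNr.
by rewrite (sublinear0 qs) sub0r.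
Qed.

Lemma sub_shift_sublinear : sublinear (sub_shift q v).
Proof.
have [qD qZ] := qs; apply: sublinearI.
- move=> x y; rewrite -lerBlDr; apply: sub_shift_ge => s s0.
  rewrite lerBlDr -lerBlDl; apply: sub_shift_ge => t t0; rewrite lerBlDl.
  rewrite (le_trans (sub_shift_le _ (addr_ge0 s0 t0)))// scalerDl addrACA.
  by have := qD (x + s *: v) (y + t *: v); lra.
- apply/eqP; rewrite eq_le (le_trans (sub_shift_le_id _)) ?(sublinear0 qs)//=.
  by apply: sub_shift_ge => s s0; rewrite add0r qZ// subrr.
- move=> r x r0; have r_ge0 := ltW r0.
  rewrite -ler_pdivrMl//; apply: sub_shift_ge => s s0.
  rewrite ler_pdivrMl// (le_trans (sub_shift_le _ (mulr_ge0 r_ge0 s0)))//.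
  by rewrite -scalerA -scalerDr qZ// mulrBr mulrA.
Qed.

End Shift.

(** Zorn's lemma for the reversed pointwise order. A nonempty chain is bounded by its pointwise
    infimum, which is finite because every member is at least [- p (- x)] at [x]. *)
Lemma exists_minimal_sublinear p : sublinear p ->
  exists f, [/\ sublinear f, forall x, f x <= p x &
    forall g, sublinear g -> (forall x, g x <= f x) -> g = f].
Proof.
move=> ps; pose T := {q : V -> R | sublinear q /\ forall x, q x <= p x}.
pose le (f g : T) := `[< forall x, sval g x <= sval f x >].
have [//|||C Ctot|[f [fs fp]] fmin] := @Zorn T le.
- by move=> f; apply/asboolP => x.
- by move=> f g h /asboolP fg /asboolP gh; apply/asboolP => x; exact: le_trans (fg x).
- move=> [f fP] [g gP] /asboolP /= fg /asboolP /= gf.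
  by apply: eq_exist; apply/funext => x; apply/eqP; rewrite eq_le fg gf.
- have [[f0 Cf0]|C0] := pselect (C !=set0); last first.
    by exists (exist _ p (conj ps (fun x => lexx _))) => f Cf; case: C0; exists f.
  pose m x := inf [set sval f x | f in C].
  have hinf x : has_inf [set sval f x | f in C].
    split; first by exists (sval f0 x), f0.
    exists (- p (- x)) => _ [[f [fs fp]] Cf <-] /=.
    by rewrite (le_trans _ (sublinear_ge _ fs))// lerN2.
  have mle f x : C f -> m x <= sval f x.
    by move=> Cf; apply: ge_inf; [case: (hinf x)|exists f].
  have mge c x : (forall f, C f -> c <= sval f x) -> c <= m x.
    move=> h; apply: lb_le_inf; first by case: (hinf x).
    by move=> _ [f Cf <-]; exact: h.
  have ms : sublinear m.
    apply: sublinearI.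
    + move=> x y; rewrite -lerBlDr; apply: (mge) => f Cf.
      rewrite lerBlDr -lerBlDl; apply: (mge) => g Cg; rewrite lerBlDl.
      have [/asboolP fg|/asboolP gf] := Ctot _ _ Cf Cg.
        have [[gD _] _] := svalP g.
        by rewrite (le_trans (mle _ _ Cg))// (le_trans (gD _ _))// lerD.
      have [[fD _] _] := svalP f.
      by rewrite (le_trans (mle _ _ Cf))// (le_trans (fD _ _))// lerD.
    + apply/eqP; rewrite eq_le; apply/andP; split.
        by rewrite (le_trans (mle _ _ Cf0))// sublinear0//; case: (svalP f0).
      by apply: (mge) => f Cf; rewrite sublinear0//; case: (svalP f).
    + move=> r x r0; rewrite -ler_pdivrMl//; apply: (mge) => f Cf.
      have [[_ fZ] _] := svalP f.
      by rewrite ler_pdivrMl// -fZ ?(ltW r0)// mle.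
  have mp x : m x <= p x.
    by rewrite (le_trans (mle _ _ Cf0))//; case: (svalP f0).
  by exists (exist _ m (conj ms mp)) => f Cf; apply/asboolP => x; exact: mle.
- exists f; split=> // g gs gf.
  have gp x : g x <= p x by rewrite (le_trans (gf x)).
  have fg : le (exist _ f (conj fs fp)) (exist _ g (conj gs gp)) by apply/asboolP.
  by have /(congr1 sval) /= := fmin _ fg.
Qed.

(** Minimality gives [sub_shift f y = f]; at [s = 1] this reads [f x <= f (x + y) - f y], the
    converse of subadditivity. *)
Lemma minimal_sublinear_linear f : sublinear f ->
  (forall g, sublinear g -> (forall x, g x <= f x) -> g = f) -> scalar f.
Proof.
move=> fs fmin; have [fD fZ] := fs.
have fDE x y : f (x + y) = f x + f y.
  apply/eqP; rewrite eq_le fD /=.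
  have := @sub_shift_le f y fs 1 x ler01.
  rewrite (fmin (sub_shift f y)); first by rewrite scale1r mul1r lerBrDr.
    exact: sub_shift_sublinear.
  exact: sub_shift_le_id.
have fN x : f (- x) = - f x.
  by apply/eqP; rewrite -addr_eq0 -fDE addNr sublinear0.
move=> r x y; rewrite fDE; congr (_ + _).
have [r0|/ltW r0] := leP 0 r; first exact: fZ.
by rewrite -{1}[r]opprK scaleNr fN fZ ?oppr_ge0// mulNr opprK.
Qed.

Theorem hahn_banach p v : sublinear p ->
  exists f : V -> R, [/\ scalar f, forall x, f x <= p x & f v = p v].
Proof.
move=> ps; have [f [fs fp fmin]] := exists_minimal_sublinear (@sub_shift_sublinear p v ps).
have fl := minimal_sublinear_linear fs fmin.
have fp' x : f x <= p x by rewrite (le_trans (fp x))// sub_shift_le_id.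
exists f; split=> //; apply/eqP; rewrite eq_le fp' /=.
have fN : f (- v) = - f v.
  by have := fl (-1) v 0; rewrite addr0 (sublinear0 fs) addr0 scaleN1r mulN1r.
by rewrite -lerN2 -fN (le_trans (fp _))// sub_shift_opp.
Qed.

End HahnBanach.

(** * States separate points *)

Section Realification.
Context {R : realType} (V : lmodType R[i]).

(** A synonym, so that restricted real scalars do not clash with the complex ones and the real
    Hahn-Banach theorem applies. *)
Definition realification : Type := V.

HB.instance Definition _ := GRing.Zmodule.copy realification V.

Definition realification_scale (r : R) (x : realification) : realification :=
  r%:C *: (x : V).

Fact realification_scaleA r s x :
  realification_scale r (realification_scale s x) = realification_scale (r * s) x.
Proof. by rewrite /realification_scale scalerA -rmorphM. Qed.
Fact realification_scale1 : left_id 1 realification_scale.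
Proof. by move=> x; exact: scale1r. Qed.
Fact realification_scaleDr : right_distributive realification_scale +%R.
Proof. by move=> r x y; exact: scalerDr. Qed.
Fact realification_scaleDl x : {morph realification_scale^~ x : r s / r + s}.
Proof. by move=> r s; rewrite /realification_scale rmorphD; exact: scalerDl. Qed.

HB.instance Definition _ := GRing.Zmodule_isLmodule.Build R realification
  realification_scaleA realification_scale1 realification_scaleDr
  realification_scaleDl.

End Realification.

(** * Linearity of states *)

Section StateLinear.
Context {R : realType} {A : cstarAlgType R}.
Context {mu : functional A}.
Hypothesis muS : state_space A mu.

Lemma stateD x y : mu (x + y) = mu x + mu y.
Proof. by have [ml _ _] := muS; have := ml 1 x y; rewrite scale1r mul1r. Qed.

Lemma state0 : mu 0 = 0.
Proof. by apply: (@addIr _ (mu 0)); rewrite -stateD !add0r. Qed.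

Lemma stateZ (k : R[i]) x : mu (k *: x) = k * mu x.
Proof. by have [ml _ _] := muS; have := ml k x 0; rewrite addr0 state0 addr0. Qed.

Lemma stateN x : mu (- x) = - mu x.
Proof. by apply/eqP; rewrite -addr_eq0 -stateD addNr state0. Qed.

Lemma stateB x y : mu (x - y) = mu x - mu y.
Proof. by rewrite stateD stateN. Qed.

End StateLinear.

(** * The support function of the state space *)

Section StateSupport.
Context {R : realType} {A : cstarAlgType R}.
Hypothesis A_neq0 : (1 : A) != 0.
Implicit Types (x y c h : A) (r t e : R).
Local Notation cst t := (t%:C *: (1 : A)).

Lemma nrm1 : nrm (1 : A) = 1.
Proof.
have := nrm_starM (1 : A); rewrite mulr1 star1 expr2 => /esym h.
by apply: (@mulfI _ (nrm (1 : A))); rewrite ?nrm_eq0// h mulr1.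
Qed.

(* [state_support x] is the supremum of [Re (mu x)] over the states [mu]. *)
Definition state_support (x : realification A) : R :=
  inf [set nrm (cst t + x) - t | t in [set t | 0 <= t]].

Lemma state_support_has_inf x :
  has_inf [set nrm (cst t + x) - t | t in [set t | 0 <= t]].
Proof.
split; first by exists (nrm (cst 0 + x) - 0), 0 => //=.
exists (- nrm x) => _ [t /= t0 <-].
have := nrmD (cst t + x) (- x).
rewrite addrK nrmN nrmZr nrm1 mulr1 ger0_norm//; lra.
Qed.

Lemma state_support_le t x : 0 <= t -> state_support x <= nrm (cst t + x) - t.
Proof.
by move=> t0; apply: ge_inf; [case: (state_support_has_inf x)|exists t].
Qed.

Lemma state_support_ge x e :
  (forall t, 0 <= t -> e <= nrm (cst t + x) - t) -> e <= state_support x.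
Proof.
move=> h; apply: lb_le_inf; first by case: (state_support_has_inf x).
by move=> _ [t /= t0 <-]; exact: h.
Qed.

Lemma state_support_sublinear : sublinear state_support.
Proof.
apply: sublinearI.
- move=> x y; rewrite -lerBlDr; apply: state_support_ge => s s0.
  rewrite lerBlDr -lerBlDl; apply: state_support_ge => t t0; rewrite lerBlDl.
  rewrite (le_trans (state_support_le _ (addr_ge0 s0 t0)))// rmorphD scalerDl.
  by rewrite addrACA; have := nrmD (cst s + x) (cst t + y); lra.
- apply/eqP; rewrite eq_le (le_trans (state_support_le _ (lexx _))) /=.
    apply: state_support_ge => t t0.
    by rewrite addr0 nrmZr nrm1 mulr1 ger0_norm// subrr.
  by rewrite scale0r addr0 nrm0 subr0.
- move=> r x r0; have r_ge0 := ltW r0.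
  rewrite -ler_pdivrMl//; apply: state_support_ge => t t0.
  rewrite ler_pdivrMl// (le_trans (state_support_le _ (mulr_ge0 r_ge0 t0)))//.
  by rewrite rmorphM -scalerA -scalerDr nrmZr ger0_norm// mulrBr.
Qed.

Lemma state_support_cposN x : cpos x -> state_support (- x) <= 0.
Proof.
move=> [_ [t t0 xt]]; rewrite (le_trans (state_support_le _ t0))//.
by rewrite subr_le0.
Qed.

(** The squared norm of [t + i h] is at most [t^2 + N^2], so the norm exceeds [t] by an amount of
    order [1 / t]. *)
Lemma state_support_skew h : star h = h -> state_support ('i%C *: h) <= 0.
Proof.
move=> hs; apply/ler_addgt0Pr => e e0; rewrite add0r.
pose N := nrm h; have N0 : 0 <= N by exact: nrm_ge0.
(* Then [t e > N^2], so [t^2 + N^2] is below the square of [t + e]. *)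
pose t := (N ^+ 2 + 1) / e.
have t0 : 0 <= t by rewrite divr_ge0 ?ltW// ltr_wpDl ?sqr_ge0.
rewrite (le_trans (state_support_le _ t0))// lerBlDr.
rewrite -(@ler_pXn2r _ 2) ?nnegrE ?nrm_ge0 ?addr_ge0 ?(ltW e0)//.
rewrite -nrm_starM starD starZr star1 starZi hs.
have -> : (cst t - 'i%C *: h) * (cst t + 'i%C *: h) = cst (t ^+ 2) + h * h.
  have ii : 'i%C * 'i%C = -1 :> R[i] by rewrite -expr2 sqr_i.
  rewrite mulrDr !mulrBl -!cscalerAl -!cscalerAr !mul1r mulr1 addrA.
  rewrite [t%:C *: ('i%C *: h)]scalerA ['i%C *: (t%:C *: h)]scalerA (mulrC t%:C) subrK.
  by rewrite !scalerA ii scaleN1r opprK -rmorphM expr2.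
rewrite (le_trans (nrmD _ _))// nrmZr nrm1 mulr1 ger0_norm ?sqr_ge0// nrm_sq//.
have te : t * e = N ^+ 2 + 1 by rewrite /t divfK ?gt_eqF.
rewrite -/N; nra.
Qed.

Lemma state_support_star x : state_support (star x) <= state_support x.
Proof.
apply: state_support_ge => t t0; rewrite (le_trans (state_support_le _ t0))//.
by rewrite -(nrm_star (cst t + star x)) starD starK starZr star1.
Qed.

(** A nonpositive support makes [e - x] positive for every [e > 0]: some [t] satisfies
    [nrm (t + x) < t + e], and [t + x] is [t + e] minus [e - x]. *)
Lemma state_support_le0_antisym h : star h = h ->
  state_support h <= 0 -> state_support (- h) <= 0 -> h = 0.
Proof.
have pos x e : star x = x -> 0 < e -> state_support x <= 0 -> cpos (cst e - x).
  move=> xs e0 px; split; first by rewrite starB starZr star1 xs.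
  have [_ [t /= t0 <-] te] := inf_lt (proj1 (state_support_has_inf x)) (le_lt_trans px e0).
  exists (t + e); first by rewrite addr_ge0// ltW.
  rewrite rmorphD scalerDl opprB addrA addrAC addrK addrC.
  by rewrite addrC -lerBlDl ltW.
move=> hs p1 p2; apply: nrm_le0; apply/ler_addgt0Pr => e e0; rewrite add0r.
have e3 : 0 < e / 3 by rewrite divr_gt0.
have := pos _ _ hs e3 p1 => c1.
have := pos _ _ _ e3 p2; rewrite opprK starN hs => /(_ erefl) c2.
have := cpos_antisym (ltW e3) c1 c2; lra.
Qed.

(** The functional is the complex-linear one with real part [f]. Domination makes [f] vanish on
    [i h] for self-adjoint [h], so values there are real. *)
Lemma state_of_dominated (f : realification A -> R) : scalar f ->
  (forall x, f x <= state_support x) ->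
  state_space A (fun a => (f a +i* - f ('i%C *: a))%C).
Proof.
move=> fl fp.
have fD x y : f (x + y) = f x + f y by have := fl 1 x y; rewrite scale1r mul1r.
have f0 : f 0 = 0 by apply: (@addIr _ (f 0)); rewrite -fD !add0r.
have fZ r x : f (r%:C *: (x : A)) = r * f x by have := fl r x 0; rewrite !addr0 f0 addr0.
have fN x : f (- x) = - f x by apply/eqP; rewrite -addr_eq0 -fD addNr f0.
have fi h : star h = h -> f ('i%C *: h) = 0.
  move=> hs; apply/eqP; rewrite eq_le (le_trans (fp _) (state_support_skew hs)) /=.
  rewrite -oppr_le0 -fN -scalerN (le_trans (fp _))// state_support_skew//.
  by rewrite starN hs.
split.
- move=> k x y; rewrite /= scalerDr !fD.
  have kE : k = (complex.Re k)%:C + (complex.Im k)%:C * 'i%C by rewrite mulrC -complexE.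
  have -> : f (k *: x) = complex.Re k * f x + complex.Im k * f ('i%C *: x).
    by rewrite {1}kE scalerDl fD -scalerA !fZ.
  have -> : f ('i%C *: (k *: x)) = complex.Re k * f ('i%C *: x) - complex.Im k * f x.
    have ii : 'i%C * 'i%C = -1 :> R[i] by rewrite -expr2 sqr_i.
    rewrite scalerA {1}kE mulrDr scalerDl fD (mulrC 'i%C (complex.Re k)%:C) mulrCA ii.
    by rewrite mulrN1 scaleNr fN -scalerA !fZ.
  by case: (k) => r s; apply/eqP; rewrite eq_complex /=; apply/andP; split; apply/eqP; ring.
- move=> a; rewrite fi ?starM ?starK// oppr0 ler0c -oppr_le0 -fN.
  by rewrite (le_trans (fp _))// state_support_cposN//; exact: cpos_starM.
- have f1 : f (1 : A) = 1.
    apply/eqP; rewrite eq_le; apply/andP; split.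
      rewrite (le_trans (fp _))// (le_trans (state_support_le _ ler01))//.
      rewrite scale1r lerBlDr (le_trans (nrmD _ _))// nrm1//.
    rewrite -lerN2 -fN (le_trans (fp _))// (le_trans (state_support_le _ ler01))//.
    by rewrite scale1r subrr nrm0 sub0r.
  by rewrite f1 fi ?star1// oppr0.
Qed.

(** By Hahn-Banach the support of each multiple of [c] is attained at a state, hence is 0. So the
    self-adjoint elements [k *: c + star (k *: c)] vanish, and [k = 1] together with [k = i] gives
    [c = 0]. *)
Theorem states_separate c : (forall mu, state_space A mu -> mu c = 0) -> c = 0.
Proof.
move=> muc.
have p0 k : state_support (k *: c) = 0.
  have [f [fl fp <-]] := hahn_banach (k *: c : realification A) state_support_sublinear.
  have st := state_of_dominated fl fp.
  have := stateZ st k c; rewrite (muc _ st) mulr0.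
  by move=> /(congr1 (@complex.Re R)).
have [pD _] := state_support_sublinear.
have re0 k : k *: c + star (k *: c) = 0.
  apply: state_support_le0_antisym.
  - by rewrite starD starK addrC.
  - by rewrite (le_trans (pD _ _))// p0 add0r (le_trans (state_support_star _))// p0.
  - rewrite opprD -starN -scaleNr (le_trans (pD _ _))// p0 add0r.
    by rewrite (le_trans (state_support_star _))// p0.
have := re0 1; rewrite scale1r => e1.
have := re0 'i%C; rewrite starZi => /eqP; rewrite subr_eq0 => /eqP.
move=> /(congr1 (fun x => - 'i%C *: x)); rewrite !scalerA mulNr -expr2 sqr_i opprK !scale1r.
by move=> cc; rewrite -(scale_half_addrr c) {2}cc e1 scaler0.
Qed.

End StateSupport.

(** * The variance of a state *)

Lemma conj_complexE (R : realType) (z : R[i]) :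
  z^*%R = (complex.Re z -i* complex.Im z)%C.
Proof. by case: z. Qed.

Section StatePositivity.
Context {R : realType} {A : cstarAlgType R}.
Context {mu : functional A}.
Hypothesis muS : state_space A mu.
Implicit Types (a b x y : A) (t : R[i]).

Lemma state1 : mu 1 = 1.
Proof. by have [_ _] := muS. Qed.

Lemma state_ge0 a : 0 <= mu (star a * a).
Proof. by have [_ mp _] := muS. Qed.

Lemma state_reE a : mu (star a * a) = (complex.Re (mu (star a * a)))%:C.
Proof. by rewrite RRe_real// ger0_real// state_ge0. Qed.

Lemma state_quadratic x y t : mu (star (x + t *: y) * (x + t *: y)) =
  mu (star x * x) + t * mu (star x * y) + t^* * mu (star y * x)
  + t^* * t * mu (star y * y).
Proof.
rewrite starD starZ mulrDr !mulrDl -!cscalerAl -!cscalerAr !(stateD muS).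
rewrite !(stateZ muS); ring.
Qed.

(** Polarisation: the value on the square of [1 + t b] is real; compare [t = 1] and [t = i]. *)
Lemma state_star b : mu (star b) = (mu b)^*%R.
Proof.
have im t : complex.Im (t * mu b + t^* * mu (star b)) = 0.
  have := ger0_Im (state_ge0 (1 + t *: b)).
  rewrite state_quadratic star1 mul1r mulr1 mul1r state1.
  rewrite [mu (star b * b)]state_reE.
  have -> : t^* * t = (complex.Re (t^* * t))%:C.
    by rewrite RRe_real// ger0_real// mulrC mul_conjC_ge0.
  by rewrite -!rmorphM -!addrA !raddfD /= add0r addr0.
have := im 1; have := im 'i%C; rewrite rmorph1 !mul1r complexiE conjCi -complexiE.
rewrite conj_complexE; case: (mu b) (mu (star b)) => [p q] [r s] /= h1 h2.
by apply/eqP; rewrite eq_complex /=; apply/andP; split; apply/eqP; lra.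
Qed.

(** The degenerate case of Cauchy-Schwarz: without its quadratic term, the nonnegative expression is
    affine in [r] with slope [- 2 W], so [W = 0]. *)
Lemma state_null_mulr y x : mu (star y * y) = 0 -> mu (x * y) = 0.
Proof.
move=> y0; rewrite -(starK x); set z := star x.
set w := mu (star z * y).
have wE : mu (star y * z) = w^*%R by rewrite /w -state_star starM starK.
pose W := complex.Re w ^+ 2 + complex.Im w ^+ 2.
pose X := complex.Re (mu (star z * z)).
have bnd r : 0 <= X - 2 * r * W.
  have := state_ge0 (z + (- (r%:C * w^*)) *: y).
  rewrite state_quadratic y0 mulr0 addr0 wE -/w.
  rewrite lecE => /andP[_]; rewrite !raddfD /= -/X !conj_complexE /W.
  by case: (w) => p q /=; lra.
have W0 : W = 0.
  have := bnd ((X + 1) / (2 * W)); have [//|Wn0] := eqVneq W 0.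
  have -> : X - 2 * ((X + 1) / (2 * W)) * W = -1 by field.
  by rewrite ler0N1.
move/eqP: W0; rewrite paddr_eq0 ?sqr_ge0// !sqrf_eq0 => /andP[/eqP re0 /eqP im0].
by apply/eqP; rewrite eq_complex re0 im0 !eqxx.
Qed.

Lemma state_compress y : mu (star y * y) != 0 ->
  state_space A (fun x => mu (star y * x * y) / mu (star y * y)).
Proof.
move=> y0; split.
- move=> k a b /=; rewrite mulrDr mulrDl -cscalerAr -cscalerAl.
  by rewrite (stateD muS) (stateZ muS) mulrDl mulrA.
- move=> a /=; rewrite divr_ge0 ?state_ge0//.
  by have := state_ge0 (a * y); rewrite starM !mulrA.
- by rewrite /= mulr1 divff.
Qed.

Lemma state_sq_le b (e : R) : 0 < e -> mu b = 0 ->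
  (forall tau : functional A, state_space A tau -> `|tau b| <= e%:C) ->
  complex.Re (mu (star b * b)) <= 4 * e ^+ 2.
Proof.
move=> e0 b0 be; set q := complex.Re _.
have qE : mu (star b * b) = q%:C by rewrite state_reE.
have q0 : 0 <= q by rewrite -ler0c -qE state_ge0.
(* With [e s = 1 / 2], the final estimate becomes [2 q <= 4 e^2 + q]. *)
pose s : R := (2 * e)^-1.
pose E (t : R[i]) : R[i] := mu (star (1 + t *: b) * b * (1 + t *: b)).
have EE t : E t = t * mu (b * b) + t^* * q%:C + t^* * t * mu (star b * b * b).
  rewrite /E starD starZ star1 mulrDr !mulrDl !mulr1 !mul1r.
  rewrite -!cscalerAl -!cscalerAr !(stateD muS) !(stateZ muS) b0 qE.
  ring.
have Eb t : t^* * t = (s ^+ 2)%:C -> `|E t| <= (e * (1 + s ^+ 2 * q))%:C.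
  move=> ts; have NE : mu (star (1 + t *: b) * (1 + t *: b)) = (1 + s ^+ 2 * q)%:C.
    rewrite state_quadratic star1 mul1r mulr1 mul1r state_star b0 state1 ts qE.
    by rewrite rmorph0 !mulr0 !addr0 rmorphD/= (rmorphM _ (s ^+ 2) q).
  have N0 : 0 < 1 + s ^+ 2 * q by rewrite ltr_wpDr// mulr_ge0// sqr_ge0.
  have Nn0 : mu (star (1 + t *: b) * (1 + t *: b)) != 0.
    by rewrite NE (inj_eq (@complexI _)) gt_eqF.
  have := be _ (state_compress Nn0); rewrite NE normrM normfV.
  rewrite [`|_%:C|]ger0_norm ?ler0c ?(ltW N0)// ler_pdivrMr ?ltcR// => h.
  by rewrite rmorphM.
have cs : (s%:C)^*%R = s%:C by rewrite conj_Creal// complex_real.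
have ci : ('i%C)^*%R = - 'i%C :> R[i] by rewrite complexiE conjCi.
have cis : ('i%C * s%:C)^*%R = - 'i%C * s%:C.
  by rewrite -ci -[in RHS]cs; exact: rmorphM.
have ii : 'i%C * 'i%C = -1 :> R[i] by rewrite -expr2 sqr_i.
have ss : s%:C * s%:C = (s ^+ 2)%:C by rewrite -rmorphM expr2.
(* The differences cancel the cubic term, which is even in [t]; the weights 1 and [i] cancel
   [mu (b * b)] and leave [q]. *)
have key : (4 * s * q)%:C = E s%:C - E (- s%:C) +
    'i%C * (E ('i%C * s%:C) - E (- ('i%C * s%:C))).
  have cN (z : R[i]) : (- z)^*%R = - z^*%R by exact: rmorphN.
  rewrite !EE !cN cs cis !rmorphM rmorph_nat.
  set I := 'i%C in ii *; set S := s%:C; set Q := q%:C.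
  set a := mu (b * b); set c := mu (star b * b * b).
  transitivity (2 * S * a * (1 + I * I) + 2 * S * Q * (1 - I * I)); last by ring.
  rewrite ii subrr mulr0 add0r opprK; ring.
have bound : `|(4 * s * q)%:C| <= (4 * (e * (1 + s ^+ 2 * q)))%:C.
  have hN t : t^* * t = (s ^+ 2)%:C -> (- t)^* * - t = (s ^+ 2)%:C.
    by rewrite rmorphN mulrNN.
  have h1 : (s%:C)^* * s%:C = (s ^+ 2)%:C by rewrite cs.
  have h2 : ('i%C * s%:C)^* * ('i%C * s%:C) = (s ^+ 2)%:C.
    by rewrite cis mulrACA mulNr ii opprK mul1r.
  have -> : 4 * (e * (1 + s ^+ 2 * q)) = (e * (1 + s ^+ 2 * q) + e * (1 + s ^+ 2 * q)) +
     (e * (1 + s ^+ 2 * q) + e * (1 + s ^+ 2 * q)) by ring.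
  rewrite key !rmorphD /=.
  rewrite (le_trans (ler_normD _ _))// lerD//.
    by rewrite (le_trans (ler_normB _ _))// lerD// Eb// hN.
  rewrite normrM complexiE normCi mul1r -complexiE.
  by rewrite (le_trans (ler_normB _ _))// lerD// Eb// hN.
have s0 : 0 < s by rewrite invr_gt0 mulr_gt0.
have es : e * s = 2^-1 by rewrite /s; field; rewrite gt_eqF.
move: bound; rewrite ger0_norm ?ler0c ?mulr_ge0 ?(ltW s0)// lecR => bound.
have : 4 * s * q * e <= 4 * (e * (1 + s ^+ 2 * q)) * e.
  by rewrite ler_wpM2r// ltW.
have -> : 4 * s * q * e = 2 * q by rewrite -!mulrA [q * e]mulrC (mulrA s) (mulrC s) es; field.
have -> : 4 * (e * (1 + s ^+ 2 * q)) * e = 4 * e ^+ 2 + 4 * (e * s) ^+ 2 * q by ring.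
rewrite es; lra.
Qed.

End StatePositivity.

(** * Invariant families *)

(** Evaluation at [c] is continuous and affine, so its zero set is closed and convex. *)
Lemma closed_convex_hull_eq0 (R : realType) (A : cstarAlgType R)
    (K : set (functional A)) (c : A) :
  (forall mu, K mu -> mu c = 0) ->
  forall mu, closed_convex_hull K mu -> mu c = 0.
Proof.
move=> Kc; suff : closed_convex_hull K `<=` [set mu | mu c = 0] by [].
apply: smallest_sub => //.
split.
  have cont : continuous (fun mu : functional A => mu c : R[i]^o).
    exact: (@proj_continuous A (fun=> R[i]^o) c).
  have /continuous_closedP/(_ [set 0]) := cont; apply.
  exact/accessible_closed_set1/hausdorff_accessible/norm_hausdorff.
move=> mu nu l; rewrite !inE /= => mu0 nu0.
by rewrite -[LHS]/(l%:num * mu c + (1 - l%:num) * nu c) mu0 nu0 !mulr0 addr0.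
Qed.

Lemma rieffel_metric_bound (R : realType) (A : cstarAlgType R) (Lip : set A)
    (L : A -> R) (mu nu : functional A) (e : R) (a : A) :
  is_lipschitz_seminorm Lip L -> state_space A mu -> state_space A nu ->
  (rieffel_metric Lip L mu nu <= e%:E)%E -> Lip a ->
  complex.Re `|mu a - nu a| <= e * (L a + 1).
Proof.
move=> LP muS nuS me La.
have [_ Lc] := lipschitz_submod LP.
have [Lip0 _] := lipschitz_submod LP; move: Lip0; rewrite inE => Lip0.
have LipZ (k : R[i]) x : Lip x -> Lip (k *: x).
  by move=> Lx; have := Lc k x 0; rewrite addr0 !inE; apply.
have L0 : L 0 = 0.
  by have := lipschitzZ LP 0 Lip0; rewrite scale0r normr0 mul0r.
have LN : L (- a) = L a.
  by rewrite -scaleN1r (lipschitzZ LP)// normrN1 mul1r.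
have La0 : 0 <= L a.
  have LNa : Lip (- a) by rewrite -scaleN1r; exact: LipZ.
  by have := lipschitzD LP La LNa; rewrite subrr L0 LN; lra.
have La1 : 0 < L a + 1 by lra.
have r0 : 0 <= (L a + 1)^-1 by rewrite invr_ge0 ltW.
(* Dividing by [L a + 1] instead of [L a] covers scalar [a], where [L a = 0]. *)
pose b : A := (L a + 1)^-1%:C *: a.
have Lb : L b <= 1.
  rewrite (lipschitzZ LP)// normc_def/= expr0n/= addr0 sqrtr_sqr ger0_norm//.
  by rewrite ler_pdivrMl// mulr1 lerDl.
have : ((complex.Re `|mu b - nu b|)%:E <= e%:E)%E.
  by apply: le_trans me; apply: ereal_sup_ubound; exists b => //; split=> //; exact: LipZ.
rewrite lee_fin (stateZ muS) (stateZ nuS) -mulrBr normrM.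
have -> : complex.Re (`|(L a + 1)^-1%:C| * `|mu a - nu a|) =
  (L a + 1)^-1 * complex.Re `|mu a - nu a|.
  rewrite ger0_norm ?ler0c// -{1}[`|mu a - nu a|]RRe_real ?normr_real//.
  by rewrite -rmorphM.
by rewrite ler_pdivrMl// mulrC.
Qed.

Lemma star_homDZ (R : realType) (A B : cstarAlgType R) (f : A -> B) k x y :
  is_unital_star_hom f -> f (k *: x + y) = k *: f x + f y.
Proof. by case=> fl _ _ _; exact: fl. Qed.

Lemma dual_map_state (R : realType) (A B : cstarAlgType R) (f : A -> B)
    (mu : functional B) :
  is_unital_star_hom f -> state_space B mu -> state_space A (dual_map f mu).
Proof.
move=> fP muS; split; rewrite /dual_map.
- move=> k x y; rewrite -(stateZ muS) -(stateD muS).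
  by congr (mu _); exact: star_homDZ.
- by move=> a; rewrite (star_homM fP) (star_hom_star fP) (state_ge0 muS).
- by rewrite (star_hom1 fP) (state1 muS).
Qed.

Lemma unital_star_hom_comp (R : realType) (A B C : cstarAlgType R)
    (g : B -> C) (f : A -> B) :
  is_unital_star_hom g -> is_unital_star_hom f -> is_unital_star_hom (g \o f).
Proof.
move=> gP fP; split=> /=.
- by move=> k x y; rewrite -(star_homDZ _ _ _ gP); congr (g _); exact: star_homDZ.
- by rewrite (star_hom1 fP) (star_hom1 gP).
- by move=> a b; rewrite (star_homM fP) (star_homM gP).
- by move=> a; rewrite (star_hom_star fP) (star_hom_star gP).
Qed.

(** * States of the invariant family and commutativity *)

Section InvariantFamily.
Context {R : realType} {M : nc_mauldin_williams R}.
Context {K : forall v : vertex M, set (functional (alg v))}.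
Hypothesis KP : invariant_family K.

(** Hiding the target algebra and the homomorphism behind existentials replaces compositions along
    paths with dependent endpoints. *)
Definition factors_with_diameter (r : R) v (mu : functional (alg v)) : Prop :=
  exists (B : cstarAlgType R) (phi : alg v -> B) (nu : functional B),
  [/\ is_unital_star_hom phi, state_space B nu, mu = dual_map phi nu &
    forall tau tau', state_space B tau -> state_space B tau' ->
    (rieffel_metric (@lip R M v) (@lipnorm R M v) (dual_map phi tau)
       (dual_map phi tau') <= r%:E)%E].

Lemma rieffel_uniformly_bounded : exists2 D : R, 0 < D &
  forall (v : vertex M) mu nu, state_space (alg v) mu -> state_space (alg v) nu ->
  (rieffel_metric (@lip R M v) (@lipnorm R M v) mu nu <= D%:E)%E.
Proof.
have /choice[D DP] := fun v => rieffel_bounded (@lipnormP R M v).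
(* The vertex set is finite, so the sum dominates every local bound. *)
exists (1 + \sum_v `|D v|).
  by rewrite ltr_pwDl// sumr_ge0.
move=> v mu nu muS nuS; apply: (le_trans (DP v mu nu muS nuS)).
rewrite lee_fin (le_trans (ler_norm _))// (bigD1 v)//= addrCA lerDl.
by rewrite addr_ge0// sumr_ge0.
Qed.

(** The invariance equation is unrolled one edge at a time, each edge contributing a factor [c]. *)
Lemma invariant_factors : exists D c : R, [/\ 0 < D, 0 < c, c < 1 &
  forall n v mu, K mu -> factors_with_diameter (c ^+ n * D) (v := v) mu].
Proof.
have [D D0 DP] := rieffel_uniformly_bounded.
have [c [c0 c1 cP]] := edge_contraction M.
exists D, c; split=> //; elim=> [|n IH] v mu Kmu.
  exists (alg v), id, mu; split=> //.
    by have [_ _ + _] := KP v; exact.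
  by move=> tau tau' tS tS'; rewrite expr0 mul1r; exact: DP.
have [_ _ _ KE] := KP v; move: Kmu; rewrite KE /= => {KE} Kmu.
case: v mu / Kmu => e nu /IH [B [phi [kap [phiP kapS nuE phiD]]]].
exists B, (phi \o @edge_hom R M e), kap; split=> //.
- by apply: unital_star_hom_comp => //; exact: edge_homP.
- by rewrite nuE.
- move=> tau tau' tS tS'.
  have := cP e _ _ (dual_map_state phiP tS) (dual_map_state phiP tS').
  move=> /le_trans; apply; rewrite exprS -mulrA EFinM.
  by apply: lee_wpmul2l; [rewrite lee_fin ltW|exact: phiD].
Qed.

(** At depth [n] all states of [B] are at most [c ^+ n * C] on [phi a], since [nu] vanishes there;
    the variance bound then tends to 0. *)
Lemma invariant_sq_eq0 v (mu : functional (alg v)) a :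
  K mu -> lip a -> mu a = 0 -> mu (star a * a) = 0.
Proof.
move=> Kmu La mua.
have muS : state_space (alg v) mu by have [_ _ + _] := KP v; exact.
have [D [c [D0 c0 c1 factor]]] := invariant_factors.
have LP := @lipnormP R M v.
pose C : R := D * (`|lipnorm a| + 1).
have C0 : 0 < C by rewrite mulr_gt0// ltr_wpDl.
suff q0 : complex.Re (mu (star a * a)) <= 0.
  rewrite (state_reE muS); congr (_%:C); apply/eqP; rewrite eq_le q0 /=.
  by rewrite -ler0c -(state_reE muS) (state_ge0 muS).
have small : (fun n => c ^+ n) @ \oo --> (0 : R).
  by apply: cvg_expr; rewrite gtr0_norm.
apply: (@le0_cvg0 _ _ (4 * C ^+ 2) _ small) => n.
have [B [phi [nu [phiP nuS muE phiD]]]] := factor n v mu Kmu.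
have e0 : 0 < c ^+ n * C by rewrite mulr_gt0// exprn_gt0.
have nu0 : nu (phi a) = 0 by rewrite -mua muE.
have := state_sq_le nuS e0 nu0; rewrite -(star_hom_star phiP) -(star_homM phiP).
have -> : nu (phi (star a * a)) = mu (star a * a) by rewrite muE.
move=> h; apply: (le_trans (h _)) => [tau tS|].
  have := rieffel_metric_bound LP (dual_map_state phiP tS)
    (dual_map_state phiP nuS) (phiD _ _ tS nuS) La.
  rewrite /dual_map nu0 subr0 => tb.
  rewrite -[`|_|]RRe_real ?normr_real// lecR (le_trans tb)// /C -!mulrA.
  by rewrite ler_pM2l ?exprn_gt0// ler_pM2l// lerD2r ler_norm.
(* The square of [c ^+ n] is at most [c ^+ n], which suffices for convergence. *)
rewrite exprMn mulrA [leRHS]mulrAC ler_wpM2r ?sqr_ge0// ler_wpM2l//.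
by rewrite expr2 ler_piMl ?exprn_ge0 ?exprn_ile1// ltW.
Qed.

(** Centring a Lipschitz [y] keeps it Lipschitz, since scalars are. Zero variance then kills
    [x * y'], so [mu] is multiplicative. *)
Lemma invariant_commutator v (mu : functional (alg v)) a b :
  K mu -> lip a -> lip b -> mu (a * b - b * a) = 0.
Proof.
move=> Kmu La Lb.
have muS : state_space (alg v) mu by have [_ _ + _] := KP v; exact.
have mul x y : lip y -> mu (x * y) = mu x * mu y.
  move=> Ly; have LP := @lipnormP R M v.
  pose y' : alg v := - mu y *: (1 : alg v) + y.
  have Ly' : lip y'.
    have [_ Lc] := lipschitz_submod LP.
    have [L1 _] : lip (1 : alg v) /\ lipnorm (1 : alg v) = 0.
      by apply/(lipschitz_eq0 LP); exists 1; rewrite scale1r.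
    by have := Lc (- mu y) 1 y; rewrite !inE; apply.
  have y0 : mu y' = 0.
    by rewrite (stateD muS) (stateZ muS) (state1 muS) mulr1 addNr.
  have := state_null_mulr muS x (invariant_sq_eq0 Kmu Ly' y0).
  rewrite mulrDr -cscalerAr mulr1 (stateD muS) (stateZ muS) mulNr => /eqP.
  by rewrite addrC subr_eq0 mulrC => /eqP.
by rewrite (stateB muS) !mul// mulrC subrr.
Qed.

Hypothesis hull : forall v : vertex M, state_space (alg v) = closed_convex_hull (@K v).

Lemma alg_commutative (v : vertex M) (a b : alg v) : a * b = b * a.
Proof.
have LP := @lipnormP R M v.
have lip_comm x y : lip x -> lip y -> x * y = y * x :> alg v.
  move=> Lx Ly; apply/subr0_eq; apply: states_separate; first exact: alg_neq0.
  rewrite hull; apply: closed_convex_hull_eq0 => mu Kmu.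
  exact: invariant_commutator.
have approx (x : alg v) (e : R) : 0 < e -> exists2 y, lip y & nrm (x - y) <= e.
  move=> e0; have e0' : 0 < e%:C by rewrite ltcR.
  have [] := @lipschitz_dense _ _ _ _ LP (ball x e%:C).
    by exists x; exact: ballxx.
    exact: ball_open.
  move=> y [+ Ly]; rewrite -ball_normE /= nrmE ltcR => /ltW xy.
  by exists y.
(* Density handles one factor at a time: replacing [y] by [z] changes the commutator by at most
   [2 * nrm x * d]. *)
have extend (x : alg v) : (forall y, lip y -> x * y = y * x) -> forall y, x * y = y * x.
  move=> xc y; apply/subr0_eq; apply: nrm_le0; apply/ler_addgt0Pr => e e0.
  rewrite add0r; pose d := e / (2 * nrm x + 1).
  have x0 := nrm_ge0 x.
  have x1 : 0 < 2 * nrm x + 1 by lra.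
  have d0 : 0 < d by rewrite divr_gt0.
  have [z Lz yz] := approx y d d0.
  have -> : x * y - y * x = x * (y - z) - (y - z) * x.
    by rewrite mulrBr mulrBl (xc _ Lz) opprB addrA subrK.
  rewrite (le_trans (nrmD _ _))// nrmN.
  have h1 : nrm (x * (y - z)) <= nrm x * d.
    by rewrite (le_trans (nrmM _ _))// ler_wpM2l.
  have h2 : nrm ((y - z) * x) <= d * nrm x.
    by rewrite (le_trans (nrmM _ _))// ler_wpM2r.
  have de : d * (2 * nrm x + 1) = e by rewrite /d divfK// gt_eqF.
  nra.
(* The first use frees the right factor; after the symmetry, the second frees the left one. *)
apply: (extend) => y Ly; apply/esym; apply: extend => x Lx; exact: lip_comm.
Qed.

End InvariantFamily.

Local Close Scope complex_scope.

Theorem corollary3p6 (R : realType) (M : nc_mauldin_williams R)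
    (K : forall v : vertex M, set (functional (alg v))) :
  no_sinks M ->
  invariant_family K ->
  (forall v : vertex M, state_space (alg v) = closed_convex_hull (K v)) ->
  forall a b : direct_sum (@alg R M), a * b = b * a.
Proof.
move=> _ KP hull a b; apply/functional_extensionality_dep => v.
exact: (alg_commutative KP hull).
Qed.
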